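(* Let $S_1,S_2,\ldots$ be i.i.d. copies of a discrete generalized Pareto random variable $S$ with tail index $\beta>0$ and slowly varying function $L$. Let $(k_n)$ be a sequence of real numbers such that, as $n\to+\infty$, $k_n\to+\infty$ and $(\ln n)\exp(k_n\beta)/n=o(L(\exp(k_n)))$. Then: (i) as $n\to+\infty$, $\sqrt{n p_{k_n}}\left(\widehat\beta_n(k_n)-\beta(k_n)\right)\Rightarrow\mathcal{N}(0,\,e^{\beta}-1)$ in distribution; (ii) as $n\to+\infty$, $$\frac{\sqrt{n\widehat p^{(n)}_{k_n}}\left(\widehat\beta_n(k_n)-\beta(k_n)\right)}{\sqrt{e^{\widehat\beta_n(k_n)}-1}}\Rightarrow\mathcal{N}(0,1)\quad\text{in distribution}.$$
   Context: $S$ is a random variable with values in $\{1,2,3,\ldots\}$ such that $\mathbb{P}(S>x)=x^{-\beta}L(x)$ for all real $x\geq 1$, where $\beta>0$ and $L:\mathbb{R}_+\to\mathbb{R}$ is slowly varying, i.e. $L(\lambda z)/L(z)\to 1$ as $z\to+\infty$ for every $\lambda>0$. For real $l$, $p_l=\mathbb{P}(S>e^{l})$ and $\widehat p^{(n)}_l=\frac1n\sum_{i=1}^n\mathbb{I}\{S_i>e^l\}$. Set $\beta(k)=\ln(p_k)-\ln(p_{k+1})$. The estimator is $\widehat\beta_n(k)=\ln(\widehat p^{(n)}_k)-\ln(\widehat p^{(n)}_{k+1})$ if $\widehat p^{(n)}_{k+1}>0$, and $\widehat\beta_n(k)=0$ if $\widehat p^{(n)}_{k+1}=0$. $\mathcal{N}(0,\sigma^2)$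 is the centered normal law with variance $\sigma^2$. On the event where the denominator in (ii) vanishes, the ratio is given an arbitrary value (e.g. $0$). *)

(* Defs.v *)
From HB Require Import structures.
From mathcomp Require Export all_boot all_order all_algebra.
From mathcomp Require Export finmap.
From mathcomp Require Export all_classical all_reals all_analysis.

Set Implicit Arguments.
Unset Strict Implicit.
Unset Printing Implicit Defensive.

Export Order.TTheory GRing.Theory Num.Theory.
Export numFieldNormedType.Exports.

Global Open Scope classical_set_scope.
Global Open Scope ring_scope.

Definition slowly_varying (R : realType) (L : R -> R) :=
  forall lambda : R, 0 < lambda -> L (lambda * z) / L z @[z --> +oo] --> (1 : R).

Definition discrete_generalized_pareto d (T : measurableType d) (R : realType)
    (P : probability T R) (S : {RV P >-> R}) (beta : R) (L : R -> R) :=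
  [/\ 0 < beta,
      slowly_varying L,
      forall w, exists k : nat, S w = k.+1%:R &
      forall x : R, 1 <= x -> ccdf S x = (x `^ (- beta) * L x)%:E].

Definition mutually_independent d (T : measurableType d) (R : realType)
    (P : probability T R) (X : nat -> {RV P >-> R}) :=
  forall (J : {fset nat}) (B : nat -> set R), (forall i, measurable (B i)) ->
    P (\bigcap_(i in [set` J]) (X i @^-1` B i)) =
    (\prod_(i <- J) P (X i @^-1` B i))%E.

(* The copies may live on another probability space than S. *)
Definition iid_copies d0 (T0 : measurableType d0) d (T : measurableType d)
    (R : realType) (P0 : probability T0 R) (S : {RV P0 >-> R})
    (P : probability T R) (X : nat -> {RV P >-> R}) :=
  mutually_independent X /\
  forall i (B : set R), measurable B -> distribution P (X i) B = distribution P0 S B.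

Definition cvg_in_distribution d (T : measurableType d) (R : realType)
    (P : probability T R) (X : nat -> T -> R)
    (mu : probability (measurableTypeR R) R) :=
  (forall n, measurable_fun setT (X n)) /\
  forall x : R, {for x, continuous (fun y : R => mu [set` `]-oo, y]])} ->
    P [set w | X n w <= x] @[n --> \oo] --> mu [set` `]-oo, x]].

(* [normal_prob] is parametrized by the standard deviation, and only denotes a
   normal law when that parameter is nonzero. *)
Definition centered_normal (R : realType) (variance : R) : probability (measurableTypeR R) R :=
  normal_prob (0 : R) (Num.sqrt variance).

Section tail_estimation.
Context d (T : measurableType d) (R : realType) (P : probability T R).

Definition tail (S : {RV P >-> R}) (l : R) : R := fine (ccdf S (expR l)).

Definition log_tail_ratio (S : {RV P >-> R}) (k : R) : R :=
  ln (tail S k) - ln (tail S (k + 1)).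

(* The sample of size n is X 0, ..., X n.-1. *)
Definition empirical_tail (X : nat -> {RV P >-> R}) (n : nat) (l : R) (w : T) : R :=
  n%:R^-1 * \sum_(i < n) \1_[set w' | expR l < X i w'] w.

Definition tail_index_estimator (X : nat -> {RV P >-> R}) (n : nat) (k : R)
    (w : T) : R :=
  if 0 < empirical_tail X n (k + 1) w then
    ln (empirical_tail X n k w) - ln (empirical_tail X n (k + 1) w)
  else 0.

End tail_estimation.

(* Main.v *)
Require Import Defs.
From mathcomp Require Import ring lra measurable_realfun.

Set Implicit Arguments.
Unset Strict Implicit.
Unset Printing Implicit Defensive.

(** Let A and B be the numbers of observations among the first n that exceed
    e^k and e^(k+1), let p and p' be the corresponding tail probabilities and
    q = p'/p, so that the estimation error is ln (A/B) - ln (1/q).  Slow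
    variation gives q -> e^(-beta), and the growth condition on k_n, which
    bounds ln n by a multiple of n p, gives n p -> +oo.

    The first convergence needs no delta method.  When B > 0, the inequality
    sqrt (n p) (ln (A/B) - ln (1/q)) <= x is the linear inequality
    c A - B <= 0 with c = q e^(-x / sqrt (n p)) ([log_ratio_leE]).  The
    left-hand side is a sum of n independent copies of a variable with at most
    three values, namely 0, c and c - 1, of mean p (c - q) ~ - q x p / sqrt (n p)
    and variance ~ p q (1 - q).  So a central limit theorem for triangular
    arrays of bounded steps says that the probability of the event is close to
    the standard normal distribution function at x sqrt (q / (1 - q)), and
    q / (1 - q) -> 1 / (e^beta - 1).  The event B = 0 has a vanishing
    probability by Chebyshev's inequality ([exceedances_concentration]).

    The central limit theorem comes with an explicit error bound
    ([walk_cdf_normal]) and is proved by Lindeberg's replacement method.  Since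
    a step takes finitely many values, the expectation of h (x + sum of n steps)
    is the n-th iterate of an averaging operator [step_avg] on finite sums of
    translates of h; it is compared with the operator of Gaussian averaging,
    whose iterates are Gaussian averages again because a convolution of
    centered normal densities is normal ([gauss_avg_comp]).  One replacement
    costs a third-order Taylor remainder ([step_avg_gauss]).  The test functions
    are cubic splines, for which the Taylor estimate is elementary and holds
    uniformly; it passes to averages of translates, so that no derivative is
    ever taken.  The Gaussian moments are read off from the integrals of
    exponential tilts of the density, which are normal densities up to a
    constant factor.

    The studentized ratio of the second convergence is the error of the first
    one, divided by its limit standard deviation, times a factor that is a
    continuous function of A/(n p), B/(n p') and 1/q, equal to 1 at
    (1, 1, e^beta) ([studentization_factor]).  Both relative counts concentrate at 1, so the
    factor tends to 1 in probability and Slutsky's argument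
    ([slutsky_quotient]) concludes; this includes the fact that the denominator
    vanishes with vanishing probability. *)

(** * Exponential tilts of the normal density *)

Section GaussianDensity.
Context {R : realType}.
Local Notation mu := (@lebesgue_measure R).
Implicit Types s t r x y z : R.

Lemma integrable_scale (k : R) (f : R -> R) : mu.-integrable setT (EFin \o f) ->
  mu.-integrable setT (EFin \o (fun x => k * f x)).
Proof.
move=> fi; rewrite (_ : EFin \o _ = (fun x => k%:E * (EFin \o f) x)%E).
  exact: integrableZl.
by apply/funext => x /=; rewrite EFinM.
Qed.

Lemma integrable_add (f g : R -> R) : mu.-integrable setT (EFin \o f) ->
  mu.-integrable setT (EFin \o g) ->
  mu.-integrable setT (EFin \o (fun x => f x + g x)).
Proof.
move=> fi gi; rewrite (_ : EFin \o _ = (EFin \o f) \+ (EFin \o g))%E.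
  exact: integrableD.
by apply/funext => x /=; rewrite EFinD.
Qed.

Lemma integrable_sub (f g : R -> R) : mu.-integrable setT (EFin \o f) ->
  mu.-integrable setT (EFin \o g) ->
  mu.-integrable setT (EFin \o (fun x => f x - g x)).
Proof.
move=> fi gi; rewrite (_ : EFin \o _ = (EFin \o f) \- (EFin \o g))%E.
  exact: integrableB.
by apply/funext => x /=; rewrite EFinB.
Qed.

Lemma normal_peakE s : 0 < s -> normal_peak s = (s * Num.sqrt (pi *+ 2))^-1.
Proof.
move=> s0; rewrite /normal_peak -mulrnAr sqrtrM ?sqr_ge0// sqrtr_sqr.
by rewrite gtr0_norm.
Qed.

Lemma normal_pdfEs (m : R) s z : 0 < s ->
  normal_pdf m s z = normal_peak s * expR (- (z - m) ^+ 2 / (s ^+ 2 *+ 2)).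
Proof. by move=> s0; rewrite normal_pdfE ?gt_eqF. Qed.

Lemma sqrt2pi_gt0 : 0 < Num.sqrt (pi *+ 2) :> R.
Proof. by rewrite sqrtr_gt0 mulrn_wgt0// pi_gt0. Qed.

(** A Gaussian tilt of a centered normal density rescales its standard deviation;
    writing the tilt in terms of the scaling factor r keeps square roots out. *)
Lemma normal_pdf_tilt_sqr s r z : 0 < s -> 0 < r ->
  expR (- ((r ^+ 2 - 1) / (s ^+ 2 *+ 2) * z ^+ 2)) * normal_pdf 0 s z =
  r^-1 * normal_pdf 0 (s / r) z.
Proof.
move=> s0 r0; rewrite !normal_pdfEs ?divr_gt0// !normal_peakE ?divr_gt0// !subr0.
have k0 := sqrt2pi_gt0.
rewrite mulrCA -expRD [RHS]mulrA; congr (_ * expR _).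
  by field; rewrite !gt_eqF.
by field; rewrite !gt_eqF.
Qed.

(** Completing the square: a linear tilt translates the normal density. *)
Lemma normal_pdf_tilt s t z : 0 < s ->
  expR (t * z) * normal_pdf 0 s z =
  expR (t ^+ 2 * s ^+ 2 / 2) * normal_pdf (t * s ^+ 2) s z.
Proof.
move=> s0; rewrite !normal_pdfEs// !(mulrCA (expR _)) -!expRD.
by congr (_ * expR _); field; rewrite gt_eqF.
Qed.

Lemma Rintegral_normal_pdf (m : R) s : \int[mu]_z normal_pdf m s z = 1.
Proof. by rewrite /Rintegral integral_normal_pdf. Qed.

Lemma integrable_tilt_sqr s r : 0 < s -> 0 < r ->
  mu.-integrable setT (EFin \o (fun z =>
    expR (- ((r ^+ 2 - 1) / (s ^+ 2 *+ 2) * z ^+ 2)) * normal_pdf 0 s z)).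
Proof.
move=> s0 r0.
have -> : (fun z => expR (- ((r ^+ 2 - 1) / (s ^+ 2 *+ 2) * z ^+ 2)) *
    normal_pdf 0 s z) = (fun z => r^-1 * normal_pdf 0 (s / r) z).
  by apply/funext => z; exact: normal_pdf_tilt_sqr.
by apply: integrable_scale; exact: integrable_normal_pdf.
Qed.

Lemma Rintegral_tilt_sqr s r : 0 < s -> 0 < r ->
  \int[mu]_z (expR (- ((r ^+ 2 - 1) / (s ^+ 2 *+ 2) * z ^+ 2)) *
    normal_pdf 0 s z) = r^-1.
Proof.
move=> s0 r0.
under eq_Rintegral do rewrite normal_pdf_tilt_sqr//.
rewrite RintegralZl//; last exact: integrable_normal_pdf.
by rewrite Rintegral_normal_pdf mulr1.
Qed.

Lemma integrable_tilt s t : 0 < s ->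
  mu.-integrable setT (EFin \o (fun z => expR (t * z) * normal_pdf 0 s z)).
Proof.
move=> s0.
have -> : (fun z => expR (t * z) * normal_pdf 0 s z) =
    (fun z => expR (t ^+ 2 * s ^+ 2 / 2) * normal_pdf (t * s ^+ 2) s z).
  by apply/funext => z; exact: normal_pdf_tilt.
by apply: integrable_scale; exact: integrable_normal_pdf.
Qed.

Lemma Rintegral_tilt s t : 0 < s ->
  \int[mu]_z (expR (t * z) * normal_pdf 0 s z) = expR (t ^+ 2 * s ^+ 2 / 2).
Proof.
move=> s0.
under eq_Rintegral do rewrite normal_pdf_tilt//.
rewrite RintegralZl//; last exact: integrable_normal_pdf.
by rewrite Rintegral_normal_pdf mulr1.
Qed.

(** The tilt with r = 1/2 has a growing exponential weight and still a finite
    integral, so it dominates the fourth power: the square of 1 + u <= e^u with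
    u = (3/16) (z/s)^2 is what is used. *)
Lemma exp4_le s z : 0 < s ->
  (z / s) ^+ 4 <= 29 * expR (- (((2^-1) ^+ 2 - 1) / (s ^+ 2 *+ 2) * z ^+ 2)).
Proof.
move=> s0; set u := (z / s) ^+ 2 * (3 / 16).
have -> : - (((2^-1) ^+ 2 - 1) / (s ^+ 2 *+ 2) * z ^+ 2) = u + u.
  by rewrite /u; field; rewrite gt_eqF.
rewrite expRD; have u0 : 0 <= u by rewrite mulr_ge0 ?sqr_ge0.
have h : u <= expR u by apply: le_trans (expR_ge1Dx u); lra.
have h2 : u * u <= expR u * expR u by rewrite ler_pM.
have -> : (z / s) ^+ 4 = (256 / 9) * (u * u) by rewrite /u; field; rewrite gt_eqF.
have := mulr_ge0 (expR_ge0 u) (expR_ge0 u); lra.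
Qed.

Lemma integrable_pow4 s : 0 < s ->
  mu.-integrable setT (EFin \o (fun z => (z / s) ^+ 4 * normal_pdf 0 s z)).
Proof.
move=> s0; have h0 : (0 : R) < 2^-1 by lra.
apply: (@le_integrable _ _ _ mu _ _ _ (EFin \o (fun z => 29 *
  (expR (- (((2^-1) ^+ 2 - 1) / (s ^+ 2 *+ 2) * z ^+ 2)) * normal_pdf 0 s z)))) => //.
- apply/measurable_EFinP; apply: measurable_funM; last exact: measurable_normal_pdf.
  by apply: measurable_funX; exact: measurable_funM.
- move=> z _ /=; have z4 : 0 <= (z / s) ^+ 4 by rewrite exprn_even_ge0.
  have p0 := normal_pdf_ge0 0 s z.
  rewrite ger0_norm ?(mulr_ge0 z4 p0)// ger0_norm; last first.
    by rewrite mulr_ge0 ?mulr_ge0// expR_ge0.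
  by rewrite lee_fin mulrA ler_wpM2r ?normal_pdf_ge0// exp4_le.
- by apply: integrable_scale; exact: integrable_tilt_sqr.
Qed.

Lemma Rintegral_pow4_le s : 0 < s ->
  \int[mu]_z ((z / s) ^+ 4 * normal_pdf 0 s z) <= 58.
Proof.
move=> s0; have h0 : (0 : R) < 2^-1 by lra.
have -> : 58 = 29 * (2^-1)^-1 :> R by rewrite invrK; lra.
rewrite -(Rintegral_tilt_sqr s0 h0) -RintegralZl//; last exact: integrable_tilt_sqr.
apply: le_Rintegral => //; first exact: integrable_pow4.
  by apply: integrable_scale; exact: integrable_tilt_sqr.
by move=> z _; rewrite mulrA ler_wpM2r ?normal_pdf_ge0// exp4_le.
Qed.

Lemma integrable_poly4 s (f : R -> R) (C : R) : 0 < s -> measurable_fun setT f ->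
  (forall z, `|f z| <= C * (1 + (z / s) ^+ 4)) ->
  mu.-integrable setT (EFin \o (fun z => f z * normal_pdf 0 s z)).
Proof.
move=> s0 mf fC.
apply: (@le_integrable _ _ _ mu _ _ _ (EFin \o (fun z =>
  C * normal_pdf 0 s z + C * ((z / s) ^+ 4 * normal_pdf 0 s z)))) => //.
- apply/measurable_EFinP; apply: measurable_funM => //; exact: measurable_normal_pdf.
- move=> z _ /=; rewrite lee_fin normrM (ger0_norm (normal_pdf_ge0 _ _ _)).
  apply: le_trans (ler_norm _).
  rewrite mulrA -mulrDl ler_wpM2r ?normal_pdf_ge0//.
  by apply: le_trans (fC z) _; rewrite mulrDr mulr1.
- apply: integrable_add.
  + by apply: integrable_scale; exact: integrable_normal_pdf.
  + by apply: integrable_scale; exact: integrable_pow4.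
Qed.

End GaussianDensity.

(** * Gaussian moments and the Taylor estimate *)

Section GaussianMoments.
Context {R : realType}.
Local Notation mu := (@lebesgue_measure R).
Implicit Types s t r x y z : R.

(** A line through (0, 1) that stays below a curve with horizontal tangent there
    is horizontal; the tangency comes from e^u (1 - u) <= 1. *)
Lemma slope_eq0 (m c : R) : 0 <= c ->
  (forall t, 1 + t * m <= expR (t ^+ 2 * c)) -> m = 0.
Proof.
move=> c0 H; apply: contrapT => /eqP m0.
have m2 : 0 < m ^+ 2 by rewrite exprn_even_gt0.
(* at t = k m the line exceeds the curve, as both k c and k m^2 are at most 1/2 *)
set k := (2 * (1 + c) * (1 + m ^+ 2))^-1.
have K0 : 0 < 2 * (1 + c) * (1 + m ^+ 2) by rewrite !mulr_gt0//; lra.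
have k0 : 0 < k by rewrite invr_gt0.
have kE : k * (2 * (1 + c) * (1 + m ^+ 2)) = 1 by rewrite mulVf// gt_eqF.
have kc : k * c <= 2^-1.
  have : 0 <= k * (1 + c) * m ^+ 2.
    by apply: mulr_ge0 (ltW m2); apply: mulr_ge0; lra.
  by nra.
have km : k * m ^+ 2 <= 2^-1.
  have : 0 <= k * c * (1 + m ^+ 2).
    by apply: mulr_ge0; [apply: mulr_ge0|]; lra.
  by nra.
have := H (k * m); set u := _ ^+ 2 * c => Hu.
have uE : u = (k * c) * (k * m ^+ 2) by rewrite /u; ring.
have kc0 : 0 <= k * c by rewrite mulr_ge0// ltW.
have km0 : 0 < k * m ^+ 2 by rewrite mulr_gt0.
have e1 := expR_ge1Dx (- u); have e2 : expR u * expR (- u) = 1 by rewrite -expRD subrr expR0.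
have e3 := expR_gt0 u.
have e4 : expR u * (1 - u) <= 1 by rewrite -[leRHS]e2 ler_pM2l.
have u1 : u <= 2^-1 * 2^-1 by rewrite uE; exact: ler_pM kc0 (ltW km0) kc km.
have e5 : (1 + k * m * m) * (1 - u) <= 1.
  by apply: le_trans e4; rewrite ler_wpM2r//; lra.
have : (1 + k * m ^+ 2) * (1 - u) <= 1 by move: e5; rewrite expr2 mulrA.
by rewrite uE; nra.
Qed.

(** Both sides agree at r = 1, so the derivatives there, - M and - 1, are equal;
    comparing values at r slightly larger and slightly smaller than 1 makes this
    elementary. *)
Lemma second_moment_eq1 (M : R) :
  (forall r, 0 < r -> 1 - (r ^+ 2 - 1) / 2 * M <= r^-1) -> M = 1.
Proof.
move=> H.
have {}H r : 0 < r -> 2 * (r - 1) <= r * (r - 1) * (r + 1) * M.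
  move=> r0; have := H r r0; rewrite -(ler_pM2r r0) mulVf ?gt_eqF//; nra.
have M0 : 0 < M by have := H 2 ltac:(lra); lra.
have [M1|M1|//] := ltgtP M 1.
  have h0 : 0 < (1 - M) / 4 by lra.
  have := H (1 + (1 - M) / 4) ltac:(lra); set h := _ / 4 in h0 *.
  have -> : 1 + h - 1 = h by ring.
  have -> : (1 + h) * h * (1 + h + 1) * M = h * ((1 + h) * (1 + h + 1) * M) by ring.
  rewrite mulrC ler_pM2l//.
  have hE : M = 1 - 4 * h by rewrite /h; field.
  rewrite hE; nra.
have h0 : 0 < (M - 1) / (3 * M) by rewrite divr_gt0//; lra.
set h := _ / _ in h0.
have hE : h * (3 * M) = M - 1 by rewrite /h divfK// gt_eqF// mulr_gt0.
have h1 : h < 3^-1 by nra.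
have := H (1 - h) ltac:(lra).
have -> : 1 - h - 1 = - h by ring.
have -> : (1 - h) * - h * (1 - h + 1) * M = - (h * ((1 - h) * (2 - h) * M)) by ring.
rewrite mulrN lerN2 (mulrC 2) ler_pM2l//.
nra.
Qed.

Lemma integrable_id_normal s : 0 < s ->
  mu.-integrable setT (EFin \o (fun z => z * normal_pdf 0 s z)).
Proof.
move=> s0; apply: (@integrable_poly4 _ s id s) => // z.
set w := z / s; have -> : z = s * w by rewrite /w mulrC divfK// gt_eqF.
rewrite normrM (gtr0_norm s0) ler_pM2l//.
have w1 : `|w| ^+ 2 = w ^+ 2 by rewrite real_normK// num_real.
have -> : w ^+ 4 = (`|w| ^+ 2) ^+ 2 by rewrite w1 -exprM.
set v := `|w|; have := sqr_ge0 (v - 2^-1); have := sqr_ge0 (v ^+ 2 - 2^-1); nra.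
Qed.

Lemma integrable_sqr_normal s : 0 < s ->
  mu.-integrable setT (EFin \o (fun z => z ^+ 2 * normal_pdf 0 s z)).
Proof.
move=> s0; apply: (@integrable_poly4 _ s (fun z => z ^+ 2) (s ^+ 2)) => // z.
set w := z / s; have -> : z = s * w by rewrite /w mulrC divfK// gt_eqF.
rewrite ger0_norm ?sqr_ge0// exprMn ler_pM2l ?exprn_gt0//.
have -> : w ^+ 4 = (w ^+ 2) ^+ 2 by rewrite -exprM.
have := sqr_ge0 w; set v := w ^+ 2 => v0; nra.
Qed.

Lemma cube_le4 (w : R) : `|w| ^+ 3 <= 1 + w ^+ 4.
Proof.
have w1 : `|w| ^+ 2 = w ^+ 2 by rewrite real_normK// num_real.
have -> : w ^+ 4 = (`|w| ^+ 2) ^+ 2 by rewrite w1 -exprM.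
have := normr_ge0 w; set v := `|w| => v0.
have := mulr_ge0 v0 (sqr_ge0 (v - 1)); nra.
Qed.

Lemma integrable_cube_normal s : 0 < s ->
  mu.-integrable setT (EFin \o (fun z => `|z| ^+ 3 * normal_pdf 0 s z)).
Proof.
move=> s0; apply: (@integrable_poly4 _ s (fun z => `|z| ^+ 3) (s ^+ 3)) => //.
  by apply: measurable_funX; exact: normr_measurable.
move=> z; set w := z / s; have -> : z = s * w by rewrite /w mulrC divfK// gt_eqF.
rewrite ger0_norm ?exprn_ge0// normrM (gtr0_norm s0) exprMn ler_pM2l ?exprn_gt0//.
exact: cube_le4.
Qed.

(** Integrating 1 + t z <= e^(t z) against the density bounds 1 + t m below
    e^(t^2 s^2 / 2) for every t. *)
Lemma normal_mean0 s : 0 < s -> \int[mu]_z (z * normal_pdf 0 s z) = 0.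
Proof.
move=> s0; apply: (@slope_eq0 _ (s ^+ 2 / 2)); first by rewrite mulr_ge0 ?sqr_ge0.
move=> t; rewrite mulrA -Rintegral_tilt//.
rewrite -{1}(Rintegral_normal_pdf 0 s) -RintegralZl//; last exact: integrable_id_normal.
have i1 : mu.-integrable setT (EFin \o normal_pdf 0 s) by exact: integrable_normal_pdf.
have i2 := integrable_scale t (integrable_id_normal s0).
rewrite -RintegralD//; apply: le_Rintegral => //.
- exact: integrable_add.
- exact: integrable_tilt.
- move=> z _; rewrite mulrA -{1}(mul1r (normal_pdf 0 s z)) -mulrDl.
  by rewrite ler_wpM2r ?normal_pdf_ge0// expR_ge1Dx.
Qed.

(** Integrating 1 - a z^2 <= e^(- a z^2), where a has either sign, compares the
    second moment with the exact value 1/r of the tilted integral. *)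
Lemma normal_second_moment s : 0 < s ->
  \int[mu]_z (z ^+ 2 * normal_pdf 0 s z) = s ^+ 2.
Proof.
move=> s0; set m := Rintegral _ _ _.
have s2 : 0 < s ^+ 2 by rewrite exprn_gt0.
suff : m / s ^+ 2 = 1 by move/(congr1 (fun x => x * s ^+ 2)); rewrite divfK ?gt_eqF// mul1r.
apply: second_moment_eq1 => r r0.
rewrite -(Rintegral_tilt_sqr s0 r0).
have -> : 1 - (r ^+ 2 - 1) / 2 * (m / s ^+ 2) =
    1 + (- ((r ^+ 2 - 1) / (s ^+ 2 *+ 2))) * m by field; rewrite gt_eqF.
set a := (r ^+ 2 - 1) / _.
rewrite -{1}(Rintegral_normal_pdf 0 s) -RintegralZl//; last exact: integrable_sqr_normal.
have i1 : mu.-integrable setT (EFin \o normal_pdf 0 s) by exact: integrable_normal_pdf.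
have i2 := integrable_scale (- a) (integrable_sqr_normal s0).
rewrite -RintegralD//; apply: le_Rintegral => //.
- exact: integrable_add.
- exact: integrable_tilt_sqr.
- move=> z _; rewrite mulrA -{1}(mul1r (normal_pdf 0 s z)) -mulrDl mulNr.
  by rewrite ler_wpM2r ?normal_pdf_ge0// expR_ge1Dx.
Qed.

Lemma normal_abs_third_moment s : 0 < s ->
  \int[mu]_z (`|z| ^+ 3 * normal_pdf 0 s z) <= 59 * s ^+ 3.
Proof.
move=> s0; have s3 : 0 < s ^+ 3 by rewrite exprn_gt0.
have i1 : mu.-integrable setT (EFin \o normal_pdf 0 s) by exact: integrable_normal_pdf.
have i4 := integrable_pow4 s0.
rewrite mulrC; apply: (@le_trans _ _ (s ^+ 3 * \int[mu]_z (normal_pdf 0 s z +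
    (z / s) ^+ 4 * normal_pdf 0 s z))).
  rewrite -RintegralZl//; last exact: integrable_add.
  apply: le_Rintegral => //; first exact: integrable_cube_normal.
    by apply: integrable_scale; exact: integrable_add.
  move=> z _; rewrite -{2}(mul1r (normal_pdf 0 s z)) -mulrDl mulrA.
  rewrite ler_wpM2r ?normal_pdf_ge0//.
  set w := z / s; have -> : z = s * w by rewrite /w mulrC divfK// gt_eqF.
  by rewrite normrM (gtr0_norm s0) exprMn ler_pM2l// cube_le4.
rewrite ler_pM2l// RintegralD//.
have := Rintegral_pow4_le s0; rewrite Rintegral_normal_pdf; lra.
Qed.

(** A function with a cubic Taylor remainder at x is averaged by the normal law up
    to the third absolute moment: c1 is annihilated by the zero mean.  The number
    c2 stands for half a second derivative. *)
Lemma normal_taylor s (h : R -> R) x c1 c2 (K : R) : 0 < s -> 0 <= K ->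
  measurable_fun setT h -> (forall y, 0 <= h y <= 1) ->
  (forall y, `|h (x + y) - (h x + y * c1 + y ^+ 2 * c2)| <= K * `|y| ^+ 3) ->
  `|\int[mu]_y (h (x + y) * normal_pdf 0 s y) - (h x + s ^+ 2 * c2)| <=
  K * (59 * s ^+ 3).
Proof.
move=> s0 K0 mh h01 hT.
have i0 : mu.-integrable setT (EFin \o normal_pdf 0 s) by exact: integrable_normal_pdf.
have i1 := integrable_id_normal s0.
have i2 := integrable_sqr_normal s0.
have i3 := integrable_cube_normal s0.
have j1 := integrable_scale c1 i1.
have j2 := integrable_scale c2 i2.
have j0 := integrable_scale (h x) i0.
have j3 := integrable_scale K i3.
have ih : mu.-integrable setT (EFin \o (fun y => h (x + y) * normal_pdf 0 s y)).
  apply: (@integrable_poly4 _ s (fun y => h (x + y)) 1) => //.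
    by apply: measurableT_comp => //; exact: measurable_funD.
  move=> z; have /andP[a b] := h01 (x + z).
  rewrite ger0_norm// mul1r (le_trans b)// lerDl exprn_even_ge0//.
have -> : h x + s ^+ 2 * c2 = \int[mu]_y (h x * normal_pdf 0 s y +
    (c1 * (y * normal_pdf 0 s y) + c2 * (y ^+ 2 * normal_pdf 0 s y))).
  rewrite !RintegralD ?RintegralZl//; last exact: integrable_add.
  by rewrite Rintegral_normal_pdf normal_mean0// normal_second_moment//; ring.
have j : mu.-integrable setT (EFin \o (fun y => h x * normal_pdf 0 s y +
    (c1 * (y * normal_pdf 0 s y) + c2 * (y ^+ 2 * normal_pdf 0 s y)))).
  by apply: integrable_add => //; exact: integrable_add.
rewrite -RintegralB//.
apply: (@le_trans _ _ (\int[mu]_y (K * (`|y| ^+ 3 * normal_pdf 0 s y)))); last first.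
  by rewrite RintegralZl// ler_wpM2l// normal_abs_third_moment.
have jd : mu.-integrable setT (EFin \o (fun y => h (x + y) * normal_pdf 0 s y -
   (h x * normal_pdf 0 s y +
    (c1 * (y * normal_pdf 0 s y) + c2 * (y ^+ 2 * normal_pdf 0 s y))))).
  exact: integrable_sub ih j.
apply: le_trans (le_normr_Rintegral _ jd) _ => //.
apply: le_Rintegral => //.
  rewrite (_ : EFin \o _ = abse \o (EFin \o (fun y => h (x + y) * normal_pdf 0 s y -
   (h x * normal_pdf 0 s y +
    (c1 * (y * normal_pdf 0 s y) + c2 * (y ^+ 2 * normal_pdf 0 s y)))))) //.
  exact: integrable_abse.
move=> y _.
have -> : h (x + y) * normal_pdf 0 s y - (h x * normal_pdf 0 s y +
    (c1 * (y * normal_pdf 0 s y) + c2 * (y ^+ 2 * normal_pdf 0 s y))) =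
   (h (x + y) - (h x + y * c1 + y ^+ 2 * c2)) * normal_pdf 0 s y by ring.
rewrite normrM (ger0_norm (normal_pdf_ge0 _ _ _)) mulrA.
by rewrite ler_wpM2r ?normal_pdf_ge0.
Qed.

End GaussianMoments.

(** * Convolution of normal densities *)

Section GaussianConvolution.
Context {R : realType}.
Local Notation mu := (@lebesgue_measure R).
Implicit Types a b c x y z w : R.

Lemma ge0_integral_translate (G : R -> R) c : continuous G -> (forall x, 0 <= G x) ->
  (\int[mu]_x (G x)%:E = \int[mu]_x (G (x - c))%:E)%E.
Proof.
move=> cG G0.
have dF : (fun x : R => x - c)^`()%classic = cst 1.
  by apply/funext => x; rewrite derive1E deriveB// derive_id derive_cst subr0.
rewrite (@increasing_ge0_integration_by_substitutionT _ (fun x : R => x - c)) //.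
- by apply: eq_integral => x _; rewrite dF /= mulr1.
- by move=> x y xy; rewrite ltrD2r.
- by rewrite dF => x; exact: cvg_cst.
- by rewrite dF; exact: is_cvg_cst.
- by rewrite dF; exact: is_cvg_cst.
- exact: cvg_addrr_Ny.
- exact: cvg_addrr.
Qed.

(** Completing the square in y: given the sum w of two independent centered normal
    variables, the first one is normal with mean a^2 w / c^2 and standard
    deviation a b / c. *)
Lemma normal_pdf_conv a b c w y : 0 < a -> 0 < b -> 0 < c ->
  c ^+ 2 = a ^+ 2 + b ^+ 2 ->
  normal_pdf 0 a y * normal_pdf 0 b (w - y) =
  normal_pdf 0 c w * normal_pdf (a ^+ 2 * w / c ^+ 2) (a * b / c) y.
Proof.
move=> a0 b0 c0 cE.
have d0 : 0 < a * b / c by rewrite divr_gt0// mulr_gt0.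
have k0 := @sqrt2pi_gt0 R.
rewrite !normal_pdfEs// !normal_peakE// !subr0.
rewrite !(mulrACA _ (expR _)) -!expRD; congr (_ * expR _).
  by field; rewrite !gt_eqF.
have -> : (a * b / c) ^+ 2 = a ^+ 2 * b ^+ 2 / c ^+ 2 by rewrite !exprMn exprVn.
have -> : b ^+ 2 = c ^+ 2 - a ^+ 2 by rewrite cE; ring.
have b2 : 0 < c ^+ 2 - a ^+ 2 by rewrite cE addrAC subrr add0r exprn_gt0.
by field; rewrite !gt_eqF.
Qed.

Lemma continuous_shift_normal (h : R -> R) b x w : 0 < b -> continuous h ->
  continuous (fun z => h (x + z) * normal_pdf 0 b (z - w)).
Proof.
move=> b0 ch z; apply: cvgM.
  apply: (@continuous_comp _ _ _ (fun z => x + z) h); last exact: ch.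
  by apply: cvgD; [exact: cvg_cst|exact: cvg_id].
apply: (@continuous_comp _ _ _ (fun z => z - w) (normal_pdf 0 b)).
  by apply: cvgB; [exact: cvg_id|exact: cvg_cst].
by apply: continuous_normal_pdf; rewrite gt_eqF.
Qed.

(** After the translation z = w - y and an exchange of the integrals, the inner
    integral is that of the conditional density of [normal_pdf_conv], which is 1. *)
Lemma gauss_convolution (h : R -> R) a b c x : 0 < a -> 0 < b -> 0 < c ->
  c ^+ 2 = a ^+ 2 + b ^+ 2 -> continuous h -> (forall y, 0 <= h y) ->
  (\int[mu]_y ((\int[mu]_z (h (x + y + z) * normal_pdf 0 b z)%:E) *
     (normal_pdf 0 a y)%:E) =
   \int[mu]_w (h (x + w) * normal_pdf 0 c w)%:E)%E.
Proof.
move=> a0 b0 c0 cE ch h0.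
have mh : measurable_fun setT h by exact: continuous_measurable_fun.
pose F (p : R * R) :=
  (h (x + p.2) * (normal_pdf 0 a p.1 * normal_pdf 0 b (p.2 - p.1)))%:E.
have mF : measurable_fun setT F.
  apply/measurable_EFinP; apply: measurable_funM.
    by apply: measurableT_comp => //; exact: measurable_funD.
  apply: measurable_funM; apply: measurableT_comp => //; try exact: measurable_normal_pdf.
  exact: measurable_funB.
have F0 p : (0 <= F p)%E by rewrite lee_fin !mulr_ge0 ?normal_pdf_ge0.
transitivity (\int[mu]_y \int[mu]_w F (y, w))%E.
  apply: eq_integral => y _.
  rewrite (@ge0_integral_translate _ y); last first.
  - by move=> z; rewrite mulr_ge0 ?normal_pdf_ge0.
  - move=> z; have := @continuous_shift_normal h b (x + y) 0 b0 ch z.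
    by under eq_fun do rewrite subr0.
  rewrite -ge0_integralZr//.
  - apply: eq_integral => w _; rewrite /F /= -EFinM; congr EFin.
    have -> : x + y + (w - y) = x + w by ring.
    ring.
  - apply/measurable_EFinP; apply: measurable_funM.
      apply: measurableT_comp => //; apply: measurable_funD => //.
      exact: measurable_funB.
    apply: (measurableT_comp (measurable_normal_pdf _ _)).
    exact: measurable_funB.
  - by move=> w _; rewrite lee_fin mulr_ge0 ?normal_pdf_ge0.
  - by rewrite lee_fin normal_pdf_ge0.
transitivity (\int[mu]_w \int[mu]_y F (y, w))%E.
  exact: (@fubini_tonelli _ _ (measurableTypeR R) (measurableTypeR R) R mu mu F mF F0).
apply: eq_integral => w _; rewrite /F /=.
under eq_integral => y _ do rewrite (normal_pdf_conv w y a0 b0 c0 cE) mulrA EFinM.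
rewrite ge0_integralZl//.
- by rewrite integral_normal_pdf mule1.
- by apply/measurable_EFinP; exact: measurable_normal_pdf.
- by move=> y _; rewrite lee_fin normal_pdf_ge0.
- by rewrite lee_fin mulr_ge0// normal_pdf_ge0.
Qed.

End GaussianConvolution.

(** * Spline test functions *)

Section SplineTestFunction.
Context {R : realType}.
Implicit Types (t x y c delta K : R) (h : R -> R).

(** The existence of c1 and c2 with a uniform bound replaces differentiability: it
    is the only consequence of three bounded derivatives that the replacement
    method uses, and it is visibly stable under averages of translates. *)
Definition cubic_remainder K h := exists c1 c2 : R -> R,
  forall x y, `|h (x + y) - (h x + y * c1 x + y ^+ 2 * c2 x)| <= K * `|y| ^+ 3.

Definition poscube t : R := Num.max 0 t ^+ 3.

Lemma poscube_le0 t : t <= 0 -> poscube t = 0.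
Proof. by move=> t0; rewrite /poscube max_l// expr0n. Qed.

Lemma poscube_ge0 t : 0 <= t -> poscube t = t ^+ 3.
Proof. by move=> t0; rewrite /poscube max_r. Qed.

Lemma continuous_poscube : continuous poscube.
Proof.
move=> t; apply: (@continuous_comp _ _ _ (fun t => Num.max 0 t) (fun t => t ^+ 3)).
  by apply: continuous_max; [exact: cvg_cst|exact: cvg_id].
exact: exprn_continuous.
Qed.

Lemma poscube_remainder : cubic_remainder 1 poscube.
Proof.
exists (fun x => 3 * Num.max 0 x ^+ 2), (fun x => 3 * Num.max 0 x) => x y.
rewrite mul1r.
have y3 : `|y| ^+ 3 = `|y ^+ 3| by rewrite normrX.
have [x0|x0] := leP 0 x; have [xy0|xy0] := leP 0 (x + y).
- rewrite !poscube_ge0// y3 (_ : _ - _ = y ^+ 3)//; ring.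
- rewrite (poscube_le0 (ltW xy0)) poscube_ge0// y3.
  have y0 : y < 0 by lra.
  rewrite (_ : 0 - _ = y ^+ 3 - (x + y) ^+ 3); last by ring.
  have h1 : (x + y) ^+ 3 = - (- (x + y)) ^+ 3 by ring.
  have h2 : y ^+ 3 = - (- y) ^+ 3 by ring.
  have h3 : (- (x + y)) ^+ 3 <= (- y) ^+ 3 by rewrite lerXn2r ?nnegrE; lra.
  have h4 : 0 <= (- (x + y)) ^+ 3 by rewrite exprn_ge0; lra.
  rewrite ler_norml; apply/andP; split; rewrite h1 h2 normrN ger0_norm; try lra.
- have y0 : 0 < y by lra.
  rewrite (poscube_le0 (ltW x0)) poscube_ge0//.
  rewrite y3 !ger0_norm ?exprn_ge0 ?(ltW y0)//.
    by rewrite expr0n /= !mulr0 !addr0 subr0 lerXn2r ?nnegrE; lra.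
  by rewrite expr0n /= !mulr0 !addr0 subr0 exprn_ge0.
- rewrite (poscube_le0 (ltW x0)) (poscube_le0 (ltW xy0)) expr0n /= !mulr0 !addr0.
  by rewrite subr0 normr0 exprn_ge0.
Qed.

(** The integral of the cardinal quadratic B-spline on [0, 3], subtracted from 1:
    a third difference of truncated cubes. *)
Definition smooth_step t : R := 1 -
  (poscube t - 3 * poscube (t - 1) + 3 * poscube (t - 2) - poscube (t - 3)) / 6.

Lemma smooth_step_left t : t <= 0 -> smooth_step t = 1.
Proof. by move=> t0; rewrite /smooth_step !poscube_le0; lra. Qed.

Lemma smooth_step_right t : 3 <= t -> smooth_step t = 0.
Proof. by move=> t0; rewrite /smooth_step !poscube_ge0; [field|lra..]. Qed.

Lemma smooth_step_ge0_le1 t : 0 <= smooth_step t <= 1.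
Proof.
have [t0|t0] := leP t 0; first by rewrite smooth_step_left// lexx ler01.
have [t3|t3] := leP 3 t; first by rewrite smooth_step_right// lexx ler01.
rewrite /smooth_step (poscube_ge0 (ltW t0)) (@poscube_le0 (t - 3)); last lra.
have [t1|t1] := leP t 1.
  rewrite !poscube_le0; [|lra..].
  have h1 : 0 <= t ^+ 3 by rewrite exprn_ge0// ltW.
  have h2 : t ^+ 3 <= 1 by rewrite exprn_ile1// ltW.
  by lra.
rewrite (@poscube_ge0 (t - 1)); last lra.
have [t2|t2] := leP t 2.
  rewrite poscube_le0; last lra.
  set u := t - 1; have -> : t = u + 1 by rewrite /u; ring.
  have u0 : 0 <= u by rewrite /u; lra.
  have u1 : u <= 1 by rewrite /u; lra.
  have h3 : 0 <= u ^+ 2 * (1 - u) by rewrite mulr_ge0 ?sqr_ge0//; lra.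
  have h4 : 0 <= u * (1 - u) by rewrite mulr_ge0//; lra.
  have h5 := exprn_ge0 3 u0.
  apply/andP; split; nra.
rewrite poscube_ge0; last lra.
set u := 3 - t; have -> : t = 3 - u by rewrite /u; ring.
have u0 : 0 <= u by rewrite /u; lra.
have u1 : u <= 1 by rewrite /u; lra.
have -> : 1 - ((3 - u) ^+ 3 - 3 * (3 - u - 1) ^+ 3 + 3 * (3 - u - 2) ^+ 3 - 0) / 6 =
  u ^+ 3 / 6 by field.
have h1 : 0 <= u ^+ 3 by rewrite exprn_ge0.
have h2 : u ^+ 3 <= 1 by rewrite exprn_ile1.
by lra.
Qed.

Lemma continuous_smooth_step : continuous smooth_step.
Proof.
have C a : continuous (fun t => poscube (t - a)).
  move=> t; apply: (@continuous_comp _ _ _ (fun t => t - a) poscube).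
    by apply: cvgB; [exact: cvg_id|exact: cvg_cst].
  exact: continuous_poscube.
move=> t; apply: cvgB; first exact: cvg_cst.
apply: cvgMl; apply: cvgB; last exact: C.
apply: cvgD; last by apply: cvgMr; exact: C.
apply: cvgB; first exact: continuous_poscube.
by apply: cvgMr; exact: C.
Qed.

(** The coefficients 1, 3, 3, 1 divided by 6 sum to 4/3 <= 2. *)
Lemma smooth_step_remainder : cubic_remainder 2 smooth_step.
Proof.
have [c1 [c2 H]] := poscube_remainder.
pose D (c : R -> R) x := - (c x - 3 * c (x - 1) + 3 * c (x - 2) - c (x - 3)) / 6.
exists (D c1), (D c2) => x y.
have := H x y; have := H (x - 1) y; have := H (x - 2) y; have := H (x - 3) y.
have E a : x - a + y = x + y - a by ring.
rewrite !E !mul1r /smooth_step /D.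
have := exprn_ge0 3 (normr_ge0 y); move: (`|y| ^+ 3) => Y Y0.
rewrite !ler_norml => /andP[a1 a2] /andP[b1 b2] /andP[d1 d2] /andP[e1 e2].
by apply/andP; split; lra.
Qed.

Definition step_at c delta t := smooth_step ((t - c) / delta).

Lemma step_at_remainder c delta : 0 < delta ->
  cubic_remainder (2 / delta ^+ 3) (step_at c delta).
Proof.
move=> d0; have [c1 [c2 H]] := smooth_step_remainder.
exists (fun x => c1 ((x - c) / delta) / delta),
  (fun x => c2 ((x - c) / delta) / delta ^+ 2) => x y.
have := H ((x - c) / delta) (y / delta); rewrite /step_at -mulrDl.
rewrite (_ : x - c + y = x + y - c); last by ring.
rewrite normrM (gtr0_norm (_ : 0 < delta^-1)) ?invr_gt0//.
have -> : 2 * (`|y| / delta) ^+ 3 = 2 / delta ^+ 3 * `|y| ^+ 3.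
  by field; rewrite gt_eqF.
move: (c1 _) (c2 _) => u v; rewrite -!(addrA (smooth_step _)).
have -> : y / delta * u + (y / delta) ^+ 2 * v =
    y * (u / delta) + y ^+ 2 * (v / delta ^+ 2) by field; rewrite gt_eqF.
by [].
Qed.

Lemma continuous_step_at c delta : continuous (step_at c delta).
Proof.
move=> t; apply: (@continuous_comp _ _ _ (fun t => (t - c) / delta) smooth_step).
  by apply: cvgMl; apply: cvgB; [exact: cvg_id|exact: cvg_cst].
exact: continuous_smooth_step.
Qed.

Lemma step_at_left c delta t : 0 < delta -> t <= c -> step_at c delta t = 1.
Proof.
move=> d0 tc; apply: smooth_step_left.
by rewrite pmulr_lle0 ?invr_gt0// subr_le0.
Qed.

Lemma step_at_right c delta t : 0 < delta -> c + 3 * delta <= t ->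
  step_at c delta t = 0.
Proof.
move=> d0 tc; apply: smooth_step_right.
by rewrite ler_pdivlMr//; lra.
Qed.

End SplineTestFunction.

(** * Lindeberg's replacement *)

Section GaussianAverage.
Context {R : realType}.
Local Notation mu := (@lebesgue_measure R).
Implicit Types (s x y : R) (h : R -> R).

Definition gauss_avg s h x : R := \int[mu]_y (h (x + y) * normal_pdf 0 s y).

Lemma integrable_gauss_avg s h x : 0 < s -> measurable_fun setT h ->
  (forall y, 0 <= h y <= 1) ->
  mu.-integrable setT (EFin \o (fun y => h (x + y) * normal_pdf 0 s y)).
Proof.
move=> s0 mh h01.
apply: (@integrable_poly4 _ s (fun y => h (x + y)) 1) => //.
  by apply: measurableT_comp => //; exact: measurable_funD.
move=> z; have /andP[a b] := h01 (x + z).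
by rewrite ger0_norm// mul1r (le_trans b)// lerDl exprn_even_ge0.
Qed.

Lemma EFin_gauss_avg s h x : 0 < s -> measurable_fun setT h ->
  (forall y, 0 <= h y <= 1) ->
  ((gauss_avg s h x)%:E = \int[mu]_y (h (x + y) * normal_pdf 0 s y)%:E)%E.
Proof.
move=> s0 mh h01; rewrite /gauss_avg /Rintegral fineK//.
exact: integrable_fin_num (integrable_gauss_avg x s0 mh h01).
Qed.

Lemma gauss_avg_ge0_le1 s h x : 0 < s -> measurable_fun setT h ->
  (forall y, 0 <= h y <= 1) -> 0 <= gauss_avg s h x <= 1.
Proof.
move=> s0 mh h01; apply/andP; split.
  apply: Rintegral_ge0 => y _; apply: mulr_ge0; last exact: normal_pdf_ge0.
  by have /andP[] := h01 (x + y).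
rewrite -[leRHS](Rintegral_normal_pdf 0 s); apply: le_Rintegral => //.
- exact: integrable_gauss_avg.
- exact: integrable_normal_pdf.
- move=> y _; rewrite ler_piMl ?normal_pdf_ge0//.
  by have /andP[] := h01 (x + y).
Qed.

Lemma measurable_gauss_avg s h : 0 < s -> measurable_fun setT h ->
  (forall y, 0 <= h y <= 1) -> measurable_fun setT (gauss_avg s h).
Proof.
move=> s0 mh h01; apply/measurable_EFinP.
pose F (p : R * R) := (h (p.1 + p.2) * normal_pdf 0 s p.2)%:E.
have mF : measurable_fun setT F.
  apply/measurable_EFinP; apply: measurable_funM.
    by apply: measurableT_comp => //; exact: measurable_funD.
  by apply: measurableT_comp => //; exact: measurable_normal_pdf.
have F0 p : (0 <= F p)%E.
  by rewrite lee_fin mulr_ge0 ?normal_pdf_ge0//; have /andP[] := h01 (p.1 + p.2).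
rewrite (_ : EFin \o _ = fubini_F mu F).
  exact: (@measurable_fun_fubini_tonelli_F _ _ (measurableTypeR R) (measurableTypeR R) R mu F mF F0).
by apply/funext => x; rewrite /= EFin_gauss_avg.
Qed.

(** Gaussian averages compose like independent sums; this is what makes the n-th
    iterate of the Gaussian operator explicit. *)
Lemma gauss_avg_comp a b c h x : 0 < a -> 0 < b -> 0 < c ->
  c ^+ 2 = a ^+ 2 + b ^+ 2 -> continuous h -> (forall y, 0 <= h y <= 1) ->
  gauss_avg a (gauss_avg b h) x = gauss_avg c h x.
Proof.
move=> a0 b0 c0 cE ch h01.
have mh : measurable_fun setT h by exact: continuous_measurable_fun.
apply: EFin_inj; rewrite !EFin_gauss_avg//; last 2 first.
- exact: measurable_gauss_avg.
- by move=> y; exact: gauss_avg_ge0_le1.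
rewrite -(gauss_convolution x a0 b0 c0 cE ch); last by move=> y; case/andP: (h01 y).
by apply: eq_integral => y _; rewrite EFinM EFin_gauss_avg.
Qed.

Lemma gauss_avg_close s (h g : R -> R) delta x : 0 < s ->
  measurable_fun setT h -> measurable_fun setT g ->
  (forall y, 0 <= h y <= 1) -> (forall y, 0 <= g y <= 1) ->
  (forall y, `|h y - g y| <= delta) ->
  `|gauss_avg s h x - gauss_avg s g x| <= delta.
Proof.
move=> s0 mh mg h01 g01 hg.
have ih := integrable_gauss_avg x s0 mh h01.
have ig := integrable_gauss_avg x s0 mg g01.
have ip : mu.-integrable setT (EFin \o normal_pdf 0 s) by exact: integrable_normal_pdf.
have id := integrable_scale delta ip.
have E : delta = \int[mu]_y (delta * normal_pdf 0 s y).
  by rewrite RintegralZl// Rintegral_normal_pdf mulr1.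
rewrite /gauss_avg; apply/ler_normlP; split.
  rewrite opprB lerBlDr [in leRHS]E -RintegralD//.
  apply: le_Rintegral => //; first exact: integrable_add.
  move=> y _; rewrite -mulrDl ler_wpM2r ?normal_pdf_ge0//.
  by have := hg (x + y); rewrite ler_norml => /andP[]; lra.
rewrite lerBlDr [in leRHS]E -RintegralD//.
apply: le_Rintegral => //; first exact: integrable_add.
move=> y _; rewrite -mulrDl ler_wpM2r ?normal_pdf_ge0//.
by have := hg (x + y); rewrite ler_norml => /andP[]; lra.
Qed.

End GaussianAverage.

Section FiniteStep.
Context {R : realType} {J : finType}.
Variables (w a : J -> R).
Hypothesis w0 : forall j, 0 <= w j.
Hypothesis w1 : \sum_j w j = 1.
Implicit Types (h : R -> R) (K x : R).

Definition step_avg h x : R := \sum_j w j * h (x + a j).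

Definition test_function K h :=
  [/\ continuous h, forall y, 0 <= h y <= 1 & cubic_remainder K h].

Lemma continuous_step_avg h : continuous h -> continuous (step_avg h).
Proof.
move=> ch; apply: continuous_big => [|j _ x]; first exact: add_continuous.
apply: cvgMr.
apply: (@continuous_comp _ _ _ (fun t => t + a j) h); last exact: ch.
by apply: cvgD; [exact: cvg_id|exact: cvg_cst].
Qed.

Lemma step_avg_ge0_le1 h : (forall y, 0 <= h y <= 1) ->
  forall y, 0 <= step_avg h y <= 1.
Proof.
move=> h01 y; apply/andP; split.
  by apply: sumr_ge0 => j _; rewrite mulr_ge0//; case/andP: (h01 (y + a j)).
rewrite -w1; apply: ler_sum => j _; rewrite ler_piMr//.
by case/andP: (h01 (y + a j)).
Qed.

Lemma step_avg_remainder K h : cubic_remainder K h -> cubic_remainder K (step_avg h).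
Proof.
move=> [c1 [c2 H]]; exists (step_avg c1), (step_avg c2) => x y.
rewrite (_ : _ - _ = \sum_j w j * (h (x + a j + y) -
    (h (x + a j) + y * c1 (x + a j) + y ^+ 2 * c2 (x + a j)))); last first.
  rewrite /step_avg !mulr_sumr -!big_split /= -sumrB; apply: eq_bigr => j _.
  by rewrite (_ : x + y + a j = x + a j + y); ring.
apply: le_trans (ler_norm_sum _ _ _) _.
rewrite -[leRHS]mul1r -w1 mulr_suml; apply: ler_sum => j _.
by rewrite normrM ger0_norm// ler_wpM2l.
Qed.

Lemma test_function_step K h : test_function K h -> test_function K (step_avg h).
Proof.
move=> [ch h01 hT]; split.
- exact: continuous_step_avg.
- exact: step_avg_ge0_le1.
- exact: step_avg_remainder.
Qed.

Variables (s A : R).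
Hypothesis s0 : 0 < s.
Hypothesis a1 : \sum_j w j * a j = 0.
Hypothesis a2 : \sum_j w j * a j ^+ 2 = s ^+ 2.
Hypothesis aA : forall j, `|a j| <= A.

Lemma step_avg_taylor K h x c1 c2 : 0 <= K ->
  (forall y, `|h (x + y) - (h x + y * c1 + y ^+ 2 * c2)| <= K * `|y| ^+ 3) ->
  `|step_avg h x - (h x + s ^+ 2 * c2)| <= K * (A * s ^+ 2).
Proof.
move=> K0 H.
rewrite (_ : _ - _ = \sum_j w j * (h (x + a j) -
    (h x + a j * c1 + a j ^+ 2 * c2))); last first.
  have a2' : \sum_j w j * a j * a j = s ^+ 2.
    by rewrite -a2; apply: eq_bigr => j _; rewrite expr2 mulrA.
  under eq_bigr do rewrite mulrBr !mulrDr !mulrA.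
  by rewrite sumrB !big_split /= -!mulr_suml w1 a1 a2' mul1r mul0r addr0.
apply: le_trans (ler_norm_sum _ _ _) _.
rewrite -a2 !mulr_sumr; apply: ler_sum => j _.
rewrite normrM (ger0_norm (w0 j)).
apply: (@le_trans _ _ (w j * (K * `|a j| ^+ 3))); first by rewrite ler_wpM2l.
have -> : `|a j| ^+ 3 = `|a j| * a j ^+ 2.
  by rewrite exprS real_normK// num_real.
rewrite (_ : K * _ = `|a j| * (K * a j ^+ 2)); last by ring.
rewrite [leRHS](_ : _ = w j * (A * (K * a j ^+ 2))); last by ring.
by rewrite ler_wpM2l// ler_wpM2r// mulr_ge0// sqr_ge0.
Qed.

(** The averages over a finitely valued step and over a normal variable with the
    same first two moments differ by their third-order remainders. *)
Lemma step_avg_gauss K h x : 0 <= K -> test_function K h ->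
  `|step_avg h x - gauss_avg s h x| <= K * (A * s ^+ 2 + 59 * s ^+ 3).
Proof.
move=> K0 [ch h01 [c1 [c2 H]]].
have mh : measurable_fun setT h by exact: continuous_measurable_fun.
have t1 := step_avg_taylor K0 (H x).
have t2 := normal_taylor s0 K0 mh h01 (H x).
rewrite -/(gauss_avg s h x) in t2.
move: t1 t2; rewrite !ler_norml => /andP[? ?] /andP[? ?]; apply/andP; split; lra.
Qed.

(** Induction on n: the first step is averaged with the finite law, which stays
    among the test functions with the same constant K, the induction hypothesis
    replaces the other steps, and the first step is then replaced inside the
    Gaussian average, which does not increase distances. *)
Lemma lindeberg K h n x : 0 <= K -> test_function K h ->
  `|iter n.+1 step_avg h x - gauss_avg (s * Num.sqrt n.+1%:R) h x| <=
  n.+1%:R * (K * (A * s ^+ 2 + 59 * s ^+ 3)).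
Proof.
move=> K0; set d := K * _.
elim: n h x => [|n IH] h x th.
  by rewrite sqrtr1 mulr1 mul1r; exact: step_avg_gauss.
have th' := test_function_step th.
have [ch h01 _] := th; have [ch' h01' _] := th'.
have mh : measurable_fun setT h by exact: continuous_measurable_fun.
have mh' : measurable_fun setT (step_avg h) by exact: continuous_measurable_fun.
have sn0 : 0 < s * Num.sqrt n.+1%:R by rewrite mulr_gt0// sqrtr_gt0.
have cE : (s * Num.sqrt n.+2%:R) ^+ 2 = (s * Num.sqrt n.+1%:R) ^+ 2 + s ^+ 2 :> R.
  by rewrite !exprMn !sqr_sqrtr// -[n.+2%:R]natr1; ring.
rewrite -(gauss_avg_comp x sn0 s0 _ cE)// ?mulr_gt0 ?sqrtr_gt0//.
rewrite iterSr.
have i1 := IH _ x th'.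
have i2 : `|gauss_avg (s * Num.sqrt n.+1%:R) (step_avg h) x -
    gauss_avg (s * Num.sqrt n.+1%:R) (gauss_avg s h) x| <= d.
  apply: gauss_avg_close => //.
  - exact: measurable_gauss_avg.
  - by move=> y; exact: gauss_avg_ge0_le1.
  - by move=> y; exact: step_avg_gauss.
rewrite -[n.+2%:R]natr1 mulrDl mul1r -(subrK (gauss_avg (s * Num.sqrt n.+1%:R) (step_avg h) x) (iter _ _ _ _)) -addrA.
by apply: le_trans (ler_normD _ _) _; rewrite lerD.
Qed.

End FiniteStep.

(** * Sums of independent finitely valued steps *)

Section IndependentSteps.
Context d (T : measurableType d) (R : realType) (P : probability T R).
Context {J : finType}.
Variables (X : nat -> {RV P >-> R}) (kappa : R -> J) (w a : J -> R).
Hypothesis indepX : mutually_independent X.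
Hypothesis measurable_kappa : forall j, measurable (kappa @^-1` [set j]).
Hypothesis law_kappa : forall i j, P (X i @^-1` (kappa @^-1` [set j])) = (w j)%:E.
Implicit Types (I : {fset nat}) (B : nat -> set R) (h : R -> R) (x : R).

Definition walk n (o : T) : R := \sum_(i < n) a (kappa (X i o)).

Lemma measurable_step_value : measurable_fun setT (a \o kappa).
Proof.
rewrite (_ : a \o kappa = fun x => \sum_j a j * \1_(kappa @^-1` [set j]) x).
  by apply: measurable_sum => j; apply: measurable_funM.
apply/funext => x /=; rewrite (bigD1 (kappa x))//= indicE mem_set// mulr1.
rewrite big1 ?addr0// => j jx; rewrite indicE memNset ?mulr0//=.
by move=> e; rewrite e eqxx in jx.
Qed.

Lemma measurable_walk n : measurable_fun setT (walk n).
Proof.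
apply: measurable_sum => i.
by apply: (measurableT_comp measurable_step_value); exact: measurable_funP.
Qed.

Definition cylinder I B := \bigcap_(i in [set` I]) X i @^-1` B i.

Lemma measurable_cylinder I B : (forall i, measurable (B i)) ->
  measurable (cylinder I B).
Proof.
move=> mB; apply: fin_bigcap_measurable => // i _.
by rewrite -[X in measurable X]setTI; apply: measurable_funP.
Qed.

Lemma cylinder_setU1 I B n (A : set R) : n \notin I ->
  cylinder (n |` I)%fset (fun i => if i == n then A else B i) =
  cylinder I B `&` X n @^-1` A.
Proof.
move=> nI; apply/seteqP; split=> o /=.
  move=> H; split; last by have := H n; rewrite /= fset1U1 eqxx => /(_ isT).
  move=> i /= iI; have := H i; rewrite /= in_fset1U iI orbT => /(_ isT).
  by case: eqP => // e; rewrite -e iI in nI.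
move=> [H Hn] i /=; rewrite in_fset1U; case: eqP => [-> _|_ /= iI] //.
exact: H.
Qed.

Lemma probability_cylinder_setU1 I B n j : (forall i, measurable (B i)) ->
  n \notin I ->
  P (cylinder I B `&` X n @^-1` (kappa @^-1` [set j])) =
  ((w j)%:E * P (cylinder I B))%E.
Proof.
move=> mB nI; rewrite -cylinder_setU1// /cylinder !indepX//; last first.
  by move=> i; case: ifP.
rewrite big_fsetU1//= eqxx law_kappa; congr (_ * _)%E.
rewrite !big_seq; apply: eq_bigr => i iI.
by case: eqP => // e; rewrite -e iI in nI.
Qed.

(** The iterates of [step_avg] compute expectations.  The induction on n needs the
    restriction to an event that concerns later observations, since the value of
    the last step is conditioned upon by moving its index into that event. *)
Lemma integral_walk n h x I B : (forall i, measurable (B i)) ->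
  (forall i, i \in I -> (n <= i)%N) -> measurable_fun setT h ->
  (forall y, 0 <= h y) ->
  (\int[P]_(o in cylinder I B) (h (x + walk n o))%:E =
   (iter n (step_avg w a) h x)%:E * P (cylinder I B))%E.
Proof.
move=> mB + mh h0; elim: n x I B mB => [|n IH] x I B mB nI.
  rewrite /walk; under eq_integral do rewrite big_ord0 addr0.
  by rewrite integral_cst//; exact: measurable_cylinder.
have nI' : n \notin I by apply/negP => /nI; rewrite ltnn.
pose F j := cylinder I B `&` X n @^-1` (kappa @^-1` [set j]).
have mF j : measurable (F j).
  rewrite /F -cylinder_setU1//; apply: measurable_cylinder => i.
  by case: ifP.
have FE : cylinder I B = \big[setU/set0]_(j <- index_enum J) F j.
  apply/seteqP; split=> o.
    move=> oI; rewrite -bigcup_seq; exists (kappa (X n o)) => //=.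
    by rewrite mem_index_enum.
  by rewrite -bigcup_seq => - [j _ []].
have mhw m : measurable_fun setT (fun o => (h (x + walk m o))%:E).
  apply/measurable_EFinP; apply: measurableT_comp => //.
  by apply: measurable_funD => //; exact: measurable_walk.
rewrite {1}FE ge0_integral_bigsetU//; first last.
- by move=> o _; rewrite lee_fin.
- exact: measurable_funTS.
- by move=> i j _ _ [z [[_ /= <-] [_ /= <-]]].
- exact: index_enum_uniq.
have PE : P (cylinder I B) = (fine (P (cylinder I B)))%:E.
  by rewrite fineK// fin_num_measure//; exact: measurable_cylinder.
rewrite (eq_bigr (fun j => (w j * iter n (step_avg w a) h (x + a j) *
    fine (P (cylinder I B)))%:E)).
  by rewrite sumEFin -mulr_suml PE -EFinM.
move=> j _; rewrite (mulrC (w j)) -mulrA [X in X = _](_ : _ =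
    \int[P]_(o in F j) (h (x + a j + walk n o))%:E)%E; last first.
  apply: eq_integral => o; rewrite inE => -[_ /= <-].
  by rewrite /walk big_ord_recr /= [in LHS](addrC (\sum_(i < n) _)) addrA.
rewrite {1}/F -cylinder_setU1// IH.
- rewrite cylinder_setU1// probability_cylinder_setU1//.
  by move: PE; set p := fine _ => ->; rewrite !EFinM.
- by move=> i; case: ifP.
- by move=> i; rewrite in_fset1U => /predU1P[->//|/nI/ltnW].
Qed.

Lemma expectation_walk n h x : measurable_fun setT h -> (forall y, 0 <= h y) ->
  (\int[P]_o (h (x + walk n o))%:E = (iter n (step_avg w a) h x)%:E)%E.
Proof.
move=> mh h0; have := @integral_walk n h x fset0 (fun=> setT) (fun=> measurableT).
rewrite /cylinder set_fset0 bigcap_set0 probability_setT mule1; apply => //.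
Qed.

End IndependentSteps.

(** * Normal approximation of the law of a sum *)

Section NormalCdf.
Context {R : realType}.
Local Notation mu := (@lebesgue_measure R).
Implicit Types s t x y c delta : R.

Definition normal_cdf s x : R := fine (normal_prob 0 s [set` `]-oo, x]]).

Lemma normal_cdfE s x :
  normal_cdf s x = \int[mu]_(z in [set` `]-oo, x]]) normal_pdf 0 s z.
Proof. by []. Qed.

Lemma integrable_normal_pdfS s (D : set R) : measurable D ->
  mu.-integrable D (EFin \o normal_pdf 0 s).
Proof.
move=> mD; apply: (@integrableS _ _ _ mu setT) => //.
exact: integrable_normal_pdf.
Qed.

(** The density is bounded by [normal_peak]. *)
Lemma normal_cdf_increment s x y : 0 < s -> x <= y ->
  0 <= normal_cdf s y - normal_cdf s x <= normal_peak s * (y - x).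
Proof.
move=> s0 xy.
rewrite !normal_cdfE Rintegral_itvB//; last exact: integrable_normal_pdfS.
apply/andP; split.
  by apply: Rintegral_ge0 => z _; exact: normal_pdf_ge0.
apply: (@le_trans _ _ (\int[mu]_(z in [set` `]x, y]]) normal_peak s)).
  apply: le_Rintegral => //.
  - exact: integrable_normal_pdfS.
  - apply/integrableP; split; first by apply/measurable_EFinP.
    under eq_integral do rewrite /= ger0_norm ?normal_peak_ge0//.
    rewrite integral_cst//= lebesgue_measure_itv /=.
    by case: ifP => _; rewrite ?mule0 ?ltry// -EFinD -EFinM ltry.
  - by move=> z _; apply: normal_pdf_ub; rewrite gt_eqF.
rewrite Rintegral_cst//= lebesgue_measure_itv /=.
by case: ifPn => //=; rewrite ?lte_fin -?leNgt ?mulr0// => yx;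
  rewrite mulr_ge0 ?normal_peak_ge0// subr_ge0.
Qed.

Lemma normal_cdf_lipschitz s x y : 0 < s ->
  `|normal_cdf s x - normal_cdf s y| <= normal_peak s * `|x - y|.
Proof.
move=> s0; wlog xy : x y / x <= y.
  move=> H; have [/H//|/ltW/H] := leP x y.
  by rewrite distrC (distrC y).
have /andP[h1 h2] := normal_cdf_increment s0 xy.
by rewrite distrC (distrC x) !ger0_norm// subr_ge0.
Qed.

Lemma normal_cdf_mkcond s x : normal_cdf s x =
  \int[mu]_z ((z <= x)%R%:R * normal_pdf 0 s z).
Proof.
rewrite normal_cdfE Rintegral_mkcond; apply: eq_Rintegral => z _.
rewrite patchE; case: ifPn => [|/negP].
  by rewrite inE /= in_itv /= => ->; rewrite mul1r.
by rewrite inE /= in_itv /= => /negP/negbTE ->; rewrite mul0r.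
Qed.

Lemma integrable_mkcond_normal s x :
  mu.-integrable setT (EFin \o (fun z => (z <= x)%R%:R * normal_pdf 0 s z)).
Proof.
have := @integrable_normal_pdfS s [set` `]-oo, x]] (measurable_itv _).
rewrite integrable_mkcond//; congr (_.-integrable _ _); apply/funext => z /=.
rewrite patchE; case: ifPn => [|/negP].
  by rewrite inE /= in_itv /= => ->; rewrite mul1r.
by rewrite inE /= in_itv /= => /negP/negbTE ->; rewrite mul0r.
Qed.

(** The test function lies between the indicator functions of two half-lines at
    distance 3 delta. *)
Lemma gauss_avg_step_bounds s c delta : 0 < s -> 0 < delta ->
  normal_cdf s c <= gauss_avg s (step_at c delta) 0 <= normal_cdf s (c + 3 * delta).
Proof.
move=> s0 d0.
have ms : measurable_fun setT (step_at c delta).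
  by apply: continuous_measurable_fun; exact: continuous_step_at.
have s01 y : 0 <= step_at c delta y <= 1 by exact: smooth_step_ge0_le1.
have ig := integrable_gauss_avg 0 s0 ms s01.
rewrite !normal_cdf_mkcond; apply/andP; split; apply: le_Rintegral => //;
  try exact: integrable_mkcond_normal.
  move=> z _; rewrite ler_wpM2r ?normal_pdf_ge0// add0r.
  have [zc|zc] := leP z c; first by rewrite step_at_left.
  by case/andP: (s01 z).
move=> z _; rewrite ler_wpM2r ?normal_pdf_ge0// add0r.
have [zc|zc] := leP z (c + 3 * delta); first by case/andP: (s01 z).
by rewrite step_at_right// ltW.
Qed.

End NormalCdf.

Section WalkLaw.
Context d (T : measurableType d) (R : realType) (P : probability T R).
Context {J : finType}.
Variables (X : nat -> {RV P >-> R}) (kappa : R -> J) (w a : J -> R).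
Hypothesis indepX : mutually_independent X.
Hypothesis measurable_kappa : forall j, measurable (kappa @^-1` [set j]).
Hypothesis law_kappa : forall i j, P (X i @^-1` (kappa @^-1` [set j])) = (w j)%:E.

Local Notation walk := (walk X kappa a).
Definition prob (A : set T) : R := fine (P A).

Lemma EFin_prob A : measurable A -> P A = (prob A)%:E.
Proof. by move=> mA; rewrite /prob fineK// fin_num_measure. Qed.

Lemma weight_ge0 j : 0 <= w j.
Proof. by rewrite -lee_fin -(law_kappa 0 j). Qed.

Lemma sum_weight : \sum_j w j = 1.
Proof.
have E := expectation_walk a indepX measurable_kappa law_kappa 1 0
  (measurable_cst (1 : R)) (fun=> ler01).
have {}E : (1%:E = (step_avg w a (cst 1) 0)%:E :> \bar R)%E.
  rewrite -E /= integral_cst//; apply/esym.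
  by transitivity (1 * 1 : \bar R)%E; [congr (_ * _)%E; exact: probability_setT|rewrite mule1].
case: E => ->; rewrite /step_avg /=.
by apply: eq_bigr => j _; rewrite mulr1.
Qed.

Lemma measurable_walk_le n x : measurable [set z | walk n z <= x].
Proof.
rewrite -[X in measurable X]setTI; apply: measurable_fun_le => //.
exact: measurable_walk.
Qed.

Lemma EFin_step_avg_walk n (h : R -> R) : measurable_fun setT h ->
  (forall y, 0 <= h y) ->
  ((iter n (step_avg w a) h 0)%:E = \int[P]_z (h (walk n z))%:E)%E.
Proof.
move=> mh h0; rewrite -(expectation_walk a indepX measurable_kappa law_kappa n 0 mh h0).
by apply: eq_integral => z _; rewrite add0r.
Qed.

(** The same comparison as in [gauss_avg_step_bounds], for the law of the sum. *)
Lemma walk_step_bounds n c delta : 0 < delta ->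
  prob [set z | walk n z <= c] <= iter n (step_avg w a) (step_at c delta) 0 <=
  prob [set z | walk n z <= c + 3 * delta].
Proof.
move=> d0.
have ms : measurable_fun setT (step_at c delta).
  by apply: continuous_measurable_fun; exact: continuous_step_at.
have s01 y : 0 <= step_at c delta y <= 1 by exact: smooth_step_ge0_le1.
have s0 y : 0 <= step_at c delta y by case/andP: (s01 y).
have mw : measurable_fun setT (fun z => (step_at c delta (walk n z))%:E).
  by apply/measurable_EFinP; apply: measurableT_comp => //; exact: measurable_walk.
have mi x : measurable_fun setT (fun z => (\1_[set z | walk n z <= x] z : R)%:E).
  by apply/measurable_EFinP; apply: measurable_indic; exact: measurable_walk_le.
have E x : (prob [set z | walk n z <= x])%:E =
    (\int[P]_z (\1_[set z | walk n z <= x] z : R)%:E)%E.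
  rewrite integral_indic//; last exact: measurable_walk_le.
  by rewrite setIT -EFin_prob//; exact: measurable_walk_le.
rewrite -!lee_fin !E EFin_step_avg_walk//; apply/andP; split;
  apply: ge0_le_integral => //; try by move=> z _; rewrite lee_fin.
  move=> z _; rewrite lee_fin indicE; have [|_] := boolP (z \in _) => //.
  by rewrite inE /= => wc; rewrite step_at_left.
move=> z _; rewrite lee_fin indicE; have [_|] := boolP (z \in _).
  by case/andP: (s01 (walk n z)).
by rewrite notin_setE /= => /negP; rewrite -ltNge => /ltW wc; rewrite step_at_right.
Qed.

Variables (s A : R).
Hypothesis s0 : 0 < s.
Hypothesis a1 : \sum_j w j * a j = 0.
Hypothesis a2 : \sum_j w j * a j ^+ 2 = s ^+ 2.
Hypothesis aA : forall j, `|a j| <= A.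

(** This turns the Gaussian remainder, of order s^3, into a multiple of A s^2. *)
Lemma std_le_bound : s <= A.
Proof.
have A0 : 0 <= A.
  have [j|J0] := pickP [pred j : J | true]; first by move=> _; apply: le_trans (aA j).
  by have := sum_weight; rewrite big_pred0// => /eqP; rewrite eq_sym oner_eq0.
rewrite -(@ler_pXn2r _ 2) ?nnegrE ?(ltW s0)// -a2 -[leRHS]mul1r -sum_weight mulr_suml.
apply: ler_sum => j _; rewrite ler_wpM2l ?weight_ge0//.
by rewrite -[leLHS]real_normK ?num_real//; apply: lerXn2r; rewrite ?nnegrE.
Qed.

(** A central limit theorem with error bound: for n s^2 fixed and A small, the free
    parameter delta, which is the width of the test functions, makes the bound
    small.  The constant is 120 = 2 (1 + 59), where 2 / delta^3 is the remainder
    constant of the test function and 59 s^3 bounds the third Gaussian moment. *)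
Lemma walk_cdf_normal n x delta : 0 < delta -> (0 < n)%N ->
  `|prob [set z | walk n z <= x] - normal_cdf (s * Num.sqrt n%:R) x| <=
  normal_peak (s * Num.sqrt n%:R) * (3 * delta) +
  120 / delta ^+ 3 * (n%:R * s ^+ 2) * A.
Proof.
case: n => // n d0 _; set sn := s * _.
have sn0 : 0 < sn by rewrite mulr_gt0// sqrtr_gt0.
have K0 : 0 <= 2 / delta ^+ 3 by rewrite divr_ge0// exprn_ge0// ltW.
have th c : test_function (2 / delta ^+ 3) (step_at c delta).
  split; first exact: continuous_step_at.
  - by move=> y; exact: smooth_step_ge0_le1.
  - exact: step_at_remainder.
have L c := lindeberg weight_ge0 sum_weight s0 a1 a2 aA n 0 K0 (th c).
set e := _ * (_ * _) in L.
have eb : e <= 120 / delta ^+ 3 * (n.+1%:R * s ^+ 2) * A.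
  have -> : 120 / delta ^+ 3 * (n.+1%:R * s ^+ 2) * A =
    n.+1%:R * (2 / delta ^+ 3 * (A * s ^+ 2 + 59 * (A * s ^+ 2))) by ring.
  rewrite /e ler_pM2l// ler_wpM2l// lerD2l ler_pM2l// exprS.
  by rewrite ler_pM2r ?exprn_gt0// std_le_bound.
have /andP[u1 _] := walk_step_bounds n.+1 x d0.
have /andP[_ u2] := walk_step_bounds n.+1 (x - 3 * delta) d0.
rewrite subrK in u2.
have /andP[_ v1] := gauss_avg_step_bounds x sn0 d0.
have /andP[v2 _] := gauss_avg_step_bounds (x - 3 * delta) sn0 d0.
have := L x; have := L (x - 3 * delta); rewrite -/sn !ler_norml.
move=> /andP[l1 l2] /andP[l3 l4].
have /andP[_ g1] := @normal_cdf_increment _ sn x (x + 3 * delta) sn0 ltac:(lra).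
have /andP[_ g2] := @normal_cdf_increment _ sn (x - 3 * delta) x sn0 ltac:(lra).
rewrite (_ : x + 3 * delta - x = 3 * delta) in g1; last by ring.
rewrite (_ : x - (x - 3 * delta) = 3 * delta) in g2; last by ring.
by apply/andP; split; lra.
Qed.

(** One averaging step adds the constant s^2 to the square function, which gives
    the variance of the sum. *)
Lemma walk_chebyshev n t : 0 < t ->
  prob [set z | t <= `|walk n z|] <= n%:R * s ^+ 2 / t ^+ 2.
Proof.
move=> t0; have t2 : 0 < t ^+ 2 by rewrite exprn_gt0.
have E m x : iter m (step_avg w a) (fun y => y ^+ 2) x = x ^+ 2 + m%:R * s ^+ 2.
  elim: m x => [|m IH] x; first by rewrite mul0r addr0.
  rewrite iterS /step_avg; under eq_bigr do rewrite IH.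
  rewrite (eq_bigr (fun j => w j * (x ^+ 2 + m%:R * s ^+ 2) +
     ((w j * a j) * (2 * x) + w j * a j ^+ 2))); last by move=> j _; ring.
  by rewrite !big_split /= -!mulr_suml sum_weight a1 a2 -natr1; ring.
have mA : measurable [set z | t <= `|walk n z|].
  rewrite -[X in measurable X]setTI; apply: measurable_fun_le => //.
  by apply: measurableT_comp => //; exact: measurable_walk.
rewrite ler_pdivlMr// mulrC -lee_fin EFinM -EFin_prob//.
have -> : n%:R * s ^+ 2 = iter n (step_avg w a) (fun y => y ^+ 2) 0.
  by rewrite E expr0n add0r.
rewrite EFin_step_avg_walk//; last by move=> y; exact: sqr_ge0.
have mw : measurable_fun setT (fun z => (walk n z ^+ 2)%:E).
  by apply/measurable_EFinP; apply: measurable_funX; exact: measurable_walk.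
apply: (@le_trans _ _ (\int[P]_(z in [set z | (t <= `|walk n z|)%R]) (walk n z ^+ 2)%:E)%E).
  rewrite -integral_cst//; apply: ge0_le_integral => //.
  - by move=> z _; rewrite lee_fin ltW.
  - exact: measurable_funTS.
  - move=> z /= tz; rewrite lee_fin -[leRHS]real_normK ?num_real//.
    by rewrite lerXn2r ?nnegrE// ltW.
apply: ge0_subset_integral => //.
by move=> z _; rewrite lee_fin sqr_ge0.
Qed.

End WalkLaw.

(** * Counts of exceedances of two levels *)

Section TwoLevels.
Context d (T : measurableType d) (R : realType) (P : probability T R).
Variables (X : nat -> {RV P >-> R}) (u u' p p' : R).
Hypothesis indepX : mutually_independent X.
Hypothesis uu' : u <= u'.
Hypothesis tail_u : forall i, P [set z | u < X i z] = p%:E.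
Hypothesis tail_u' : forall i, P [set z | u' < X i z] = p'%:E.

(** An observation matters only through its position with respect to both levels;
    the value (false, true) has probability 0. *)
Definition levels (x : R) : bool * bool := (u < x, u' < x).

Definition level_weight (j : bool * bool) : R :=
  if j.1 then (if j.2 then p' else p - p') else (if j.2 then 0 else 1 - p).

(** A linear combination of the two indicators, centered and scaled. *)
Definition level_step (r alpha gamma : R) (j : bool * bool) : R :=
  r * (alpha * j.1%:R + gamma * j.2%:R - (alpha * p + gamma * p')).

Definition exceedances (v : R) n (z : T) : R := \sum_(i < n) (v < X i z)%R%:R.

Let mgt (v : R) : measurable [set x : R | v < x].
Proof. by rewrite -set_itvoy; exact: measurable_itv. Qed.

Let mX (B : set R) i : measurable B -> measurable (X i @^-1` B).
Proof. by move=> mB; rewrite -[X in measurable X]setTI; apply: measurable_funP. Qed.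

Lemma measurable_levels j : measurable (levels @^-1` [set j]).
Proof.
have M (v : R) (b : bool) : measurable [set x : R | (v < x) = b].
  case: b; first exact: mgt.
  rewrite (_ : [set x | _] = ~` [set x | v < x]); first exact: measurableC.
  by apply/seteqP; split=> x /=; [move=> ->|move/negP/negbTE].
case: j => b1 b2; rewrite (_ : _ @^-1` _ = [set x | (u < x) = b1] `&` [set x | (u' < x) = b2]).
  by apply: measurableI; exact: M.
by apply/seteqP; split=> x /=; [case=> -> ->|case=> <- <-].
Qed.

Lemma law_levels i j : P (X i @^-1` (levels @^-1` [set j])) = (level_weight j)%:E.
Proof.
have m1 := mX i (mgt u); have m2 := mX i (mgt u').
case: j => -[] [] /=; rewrite /level_weight /=.
- rewrite -(tail_u' i); congr (P _); apply/seteqP; split=> z /=; first by case.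
  by move=> h; rewrite /levels h (le_lt_trans uu' h).
- rewrite (_ : _ @^-1` _ = [set z | u < X i z] `\` [set z | u' < X i z]).
    rewrite measureD//; last by rewrite (le_lt_trans (probability_le1 _ _))// ltry.
    rewrite setIidr; first by rewrite EFinB -(tail_u i) -(tail_u' i).
    by move=> z /=; exact: le_lt_trans.
  by apply/seteqP; split=> z /=; [case=> -> ->|move=> [h /negP/negbTE h']; rewrite /levels h h'].
- rewrite (_ : _ @^-1` _ = set0) ?measure0//.
  apply/seteqP; split=> z //= -[h1 h2].
  by move: (le_lt_trans uu' h2); rewrite h1.
- rewrite (_ : _ @^-1` _ = ~` [set z | u < X i z]).
    by rewrite probability_setC// EFinB -(tail_u i).
  apply/seteqP; split=> z /=; first by case=> ->.
  move/negP/negbTE => h; rewrite /levels h; congr (_, _).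
  by apply/negP => /(le_lt_trans uu'); rewrite h.
Qed.

Lemma big_levels (F : bool * bool -> R) : \sum_j F j =
  F (true, true) + F (true, false) + F (false, true) + F (false, false).
Proof.
rewrite (eq_bigr (fun j => F (j.1, j.2))); last by case.
by rewrite -(pair_bigA _ (fun a b => F (a, b))) /= !big_bool /= addrA.
Qed.

Lemma tail_bounds : [/\ 0 <= p', p' <= p & p <= 1].
Proof.
have h := weight_ge0 law_levels; split.
- exact: (h (true, true)).
- by have := h (true, false); rewrite /level_weight /= subr_ge0.
- by have := h (false, false); rewrite /level_weight /= subr_ge0.
Qed.

(** The variance of alpha times the indicator of X > u plus gamma times that of
    X > u'; the product of the two indicators is the second one. *)
Definition level_var (alpha gamma : R) : R :=
  alpha ^+ 2 * p + (2 * alpha + gamma) * gamma * p' - (alpha * p + gamma * p') ^+ 2.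

Lemma level_step_mean r alpha gamma :
  \sum_j level_weight j * level_step r alpha gamma j = 0.
Proof. by rewrite big_levels /level_weight /level_step /=; ring. Qed.

Lemma level_step_var r alpha gamma :
  \sum_j level_weight j * level_step r alpha gamma j ^+ 2 =
  r ^+ 2 * level_var alpha gamma.
Proof. by rewrite big_levels /level_weight /level_step /level_var /=; ring. Qed.

Lemma level_step_bound r alpha gamma j :
  `|level_step r alpha gamma j| <= 2 * `|r| * (`|alpha| + `|gamma|).
Proof.
have [q0 qp p1] := tail_bounds.
rewrite /level_step normrM (mulrC 2) -mulrA ler_wpM2l//.
apply: le_trans (ler_normB _ _) _.
have h (x y : R) (b c : R) : 0 <= b <= 1 -> 0 <= c <= 1 -> `|x * b + y * c| <= `|x| + `|y|.
  move=> /andP[b0 b1] /andP[c0 c1]; apply: le_trans (ler_normD _ _) _.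
  by rewrite !normrM (ger0_norm b0) (ger0_norm c0) lerD// ler_piMr.
have h1 : `|alpha * j.1%:R + gamma * j.2%:R| <= `|alpha| + `|gamma|.
  by apply: h; [case: j.1|case: j.2]; rewrite /= ?lexx ?ler01.
have h2 : `|alpha * p + gamma * p'| <= `|alpha| + `|gamma|.
  by apply: h; apply/andP; split; lra.
lra.
Qed.

Lemma walk_levels r alpha gamma n z :
  walk X levels (level_step r alpha gamma) n z =
  r * (alpha * exceedances u n z + gamma * exceedances u' n z -
       n%:R * (alpha * p + gamma * p')).
Proof.
rewrite /walk /level_step /levels /exceedances -mulr_sumr; congr (_ * _).
rewrite sumrB big_split /= -!mulr_sumr; congr (_ - _).
by rewrite sumr_const card_ord mulr_natl.
Qed.

(** A single level is the case alpha = 1, gamma = 0. *)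
Lemma exceedances_chebyshev n t : 0 < t ->
  prob P [set z | t <= `|exceedances u n z - n%:R * p|] <= n%:R * p / t ^+ 2.
Proof.
move=> t0; have [q0 qp p1] := tail_bounds.
have v0 : 0 <= level_var 1 0 by rewrite /level_var; nra.
have := @walk_chebyshev _ _ _ _ _ X levels level_weight (level_step 1 1 0)
  indepX measurable_levels law_levels (Num.sqrt (level_var 1 0))
  (level_step_mean _ _ _) _ n t t0.
rewrite sqr_sqrtr// level_step_var expr1n mul1r => /(_ erefl).
rewrite (_ : [set z | _] = [set z | t <= `|exceedances u n z - n%:R * p|]); last first.
  by apply/seteqP; split=> z /=; rewrite walk_levels !mul1r !mul0r !addr0.
move=> h; apply: le_trans h _.
rewrite ler_wpM2r ?invr_ge0 ?sqr_ge0// ler_wpM2l// /level_var; nra.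
Qed.

(** The scale r normalizes the sum to standard deviation v, and the threshold 0
    becomes the opposite of the scaled mean. *)
Lemma exceedances_cdf_normal n v r alpha gamma delta : (0 < n)%N -> 0 < v -> 0 < delta ->
  0 < level_var alpha gamma ->
  r = v / (Num.sqrt (level_var alpha gamma) * Num.sqrt n%:R) ->
  `|prob P [set z | alpha * exceedances u n z + gamma * exceedances u' n z <= 0] -
    normal_cdf v (- (r * (n%:R * (alpha * p + gamma * p'))))| <=
  normal_peak v * (3 * delta) + 120 / delta ^+ 3 * v ^+ 2 *
    (2 * r * (`|alpha| + `|gamma|)).
Proof.
move=> n0 v0 d0 V0 rE.
have sn0 : 0 < Num.sqrt n%:R :> R by rewrite sqrtr_gt0 ltr0n.
have sV0 : 0 < Num.sqrt (level_var alpha gamma) by rewrite sqrtr_gt0.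
have r0 : 0 < r by rewrite rE divr_gt0// mulr_gt0.
have nE : n%:R = Num.sqrt n%:R ^+ 2 :> R by rewrite sqr_sqrtr.
have s0 : 0 < v / Num.sqrt n%:R by rewrite divr_gt0.
have a2 : \sum_j level_weight j * level_step r alpha gamma j ^+ 2 =
    (v / Num.sqrt n%:R) ^+ 2.
  rewrite level_step_var -{1}(sqr_sqrtr (ltW V0)) rE.
  by field; rewrite !gt_eqF.
have aA j : `|level_step r alpha gamma j| <= 2 * r * (`|alpha| + `|gamma|).
  by have := level_step_bound r alpha gamma j; rewrite (gtr0_norm r0).
have := walk_cdf_normal indepX measurable_levels law_levels s0
  (level_step_mean r alpha gamma) a2 aA
  (- (r * (n%:R * (alpha * p + gamma * p')))) d0 n0.
rewrite divfK ?gt_eqF// (_ : n%:R * (v / _) ^+ 2 = v ^+ 2); last first.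
  by rewrite {1}nE; field; rewrite gt_eqF.
rewrite (_ : [set z | _ <= - _] =
  [set z | alpha * exceedances u n z + gamma * exceedances u' n z <= 0])//.
apply/seteqP; split=> z /=; rewrite walk_levels mulrBr.
  by rewrite lerBlDr addNr pmulr_rle0.
by rewrite lerBlDr addNr pmulr_rle0.
Qed.

End TwoLevels.

(** * Tail probabilities of a discrete generalized Pareto variable *)

Section ParetoTail.
Context d0 (T0 : measurableType d0) (R : realType) (P0 : probability T0 R).
Variables (S : {RV P0 >-> R}) (beta : R) (L : R -> R) (k : nat -> R).
Hypothesis paretoS : discrete_generalized_pareto S beta L.
Hypothesis k_cvg : k n @[n --> \oo] --> +oo.

Lemma tail_ge0 l : 0 <= tail S l.
Proof. exact: fine_ge0. Qed.

Lemma tail_paretoE l : 0 <= l -> tail S l = expR (- (l * beta)) * L (expR l).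
Proof.
case: paretoS => _ _ _ H l0; rewrite /tail H/=; last by rewrite -expR0 ler_expR.
by rewrite /powR gt_eqF ?expR_gt0// expRK mulNr (mulrC beta).
Qed.

Lemma near_k_ge0 : \forall n \near \oo, 0 <= k n.
Proof. by move/cvgryPge : k_cvg => /(_ 0). Qed.

Lemma tail_ratio_cvg : tail S (k n + 1) / tail S (k n) @[n --> \oo] --> expR (- beta).
Proof.
have [_ sv _ _] := paretoS.
have /sv sv1 : 0 < expR 1 :> R by exact: expR_gt0.
have kk : expR (k n) @[n --> \oo] --> +oo.
  apply/cvgryPge => A; near=> n.
  have kA : A <= k n by near: n; move/cvgryPge : k_cvg => /(_ A).
  by have := expR_ge1Dx (k n); lra.
have h : L (expR 1 * expR (k n)) / L (expR (k n)) @[n --> \oo] --> (1 : R).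
  exact: (cvg_comp (fun n => expR (k n)) (fun z => L (expR 1 * z) / L z) kk sv1).
have : expR (- beta) * (L (expR 1 * expR (k n)) / L (expR (k n))) @[n --> \oo] -->
    expR (- beta) * 1 by apply: cvgMr; exact: h.
rewrite mulr1; apply: cvg_trans; apply: near_eq_cvg.
near=> n.
have k0 : 0 <= k n by near: n; exact: near_k_ge0.
rewrite !tail_paretoE ?addr_ge0// (addrC (k n) 1).
rewrite (_ : - ((1 + k n) * beta) = - beta + - (k n * beta)); last by ring.
rewrite (expRD 1) (expRD (- beta)) invfM.
have E0 : expR (- (k n * beta)) != 0 by rewrite gt_eqF// expR_gt0.
by move: (L (expR (k n)))^-1 => y; field.
Unshelve. all: end_near. Qed.

(** The ratio of consecutive tails is 0 when its denominator is 0, and it has a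
    positive limit. *)
Lemma near_tail_gt0 : \forall n \near \oo, 0 < tail S (k n).
Proof.
have H := cvgr_gt (expR (- beta)) tail_ratio_cvg 0 (expR_gt0 _).
near=> n; rewrite lt_neqAle tail_ge0 andbT eq_sym; apply/eqP => t0.
have : 0 < tail S (k n + 1) / tail S (k n) by near: n; exact: H.
by rewrite t0 invr0 mulr0 ltxx.
Unshelve. all: end_near. Qed.

(** The growth condition with constant 1 reads ln n <= n p for large n. *)
Lemma size_tail_cvgy :
  (fun n => ln (n%:R : R) * expR (k n * beta) / n%:R) =o_\oo
    (fun n => L (expR (k n))) ->
  n%:R * tail S (k n) @[n --> \oo] --> +oo.
Proof.
move=> /eqoP/(_ 1 ltr01) H.
apply/cvgryPge => A; near=> n.
have k0 : 0 <= k n by near: n; exact: near_k_ge0.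
have n0 : (0 : R) < n%:R.
  by rewrite ltr0n; near: n; exact: nbhs_infty_gt.
have An : expR A <= n%:R by near: n; exact: nbhs_infty_ger.
have : `|ln (n%:R : R) * expR (k n * beta) / n%:R| <= 1 * `|L (expR (k n))|.
  by near: n; exact: H.
have e0 := expR_gt0 (k n * beta).
have ee : expR (- (k n * beta)) * expR (k n * beta) = 1.
  by rewrite -expRD addNr expR0.
have LE : L (expR (k n)) = expR (k n * beta) * tail S (k n).
  by rewrite tail_paretoE// mulrA (mulrC (expR _)) ee mul1r.
rewrite mul1r LE (ger0_norm (mulr_ge0 (ltW e0) (tail_ge0 _))).
move/(le_trans (ler_norm _)).
rewrite mulrAC mulrC ler_pM2l// ler_pdivrMr// (mulrC _ n%:R); apply: le_trans.
by rewrite -[leLHS]expRK ler_ln ?posrE ?expR_gt0.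
Unshelve. all: end_near. Qed.

End ParetoTail.

(** * Limits of distribution functions *)

Section ConvergenceOfLaws.
Context d (T : measurableType d) (R : realType) (P : probability T R).
Local Notation prob := (prob P).

Lemma prob_ge0 A : 0 <= prob A.
Proof. exact: fine_ge0. Qed.

Lemma prob_le_setU A B C : measurable A -> measurable B -> measurable C ->
  A `<=` B `|` C -> prob A <= prob B + prob C.
Proof.
move=> mA mB mC ABC; rewrite -lee_fin EFinD -!EFin_prob//.
apply: (@le_trans _ _ (P (B `|` C))); last exact: measureU2.
by apply: le_measure => //; rewrite inE//; exact: measurableU.
Qed.

(** The parameter delta is chosen before n, so that e n absorbs delta^(-3). *)
Lemma cvg_normal_cdf_of_bound v t0 (u t e : nat -> R) : 0 < v ->
  t n @[n --> \oo] --> t0 -> e n @[n --> \oo] --> 0 ->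
  (forall delta, 0 < delta -> \forall n \near \oo,
    `|u n - normal_cdf v (t n)| <=
    normal_peak v * (3 * delta) + 120 / delta ^+ 3 * v ^+ 2 * e n) ->
  u n @[n --> \oo] --> normal_cdf v t0.
Proof.
move=> v0 tt0 e0 H; have p0 : 0 < normal_peak v by rewrite normal_peak_gt0 ?gt_eqF.
apply/cvgrPdist_le => eps eps0.
pose delta := eps / (9 * normal_peak v).
have d0 : 0 < delta by rewrite divr_gt0// mulr_gt0.
have dE : normal_peak v * (3 * delta) = eps / 3 by rewrite /delta; field; rewrite gt_eqF.
pose K := 120 / delta ^+ 3 * v ^+ 2.
have K0 : 0 < K by rewrite mulr_gt0 ?exprn_gt0// divr_gt0// exprn_gt0.
have {}H := H _ d0.
move/cvgrPdist_le : tt0 => /(_ (eps / (3 * normal_peak v))) tt0.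
move/cvgrPdist_le : e0 => /(_ (eps / (3 * K))) e0.
near=> n.
have h1 : `|t0 - t n| <= eps / (3 * normal_peak v).
  by near: n; apply: tt0; rewrite divr_gt0// mulr_gt0.
have h2 : `|0 - e n| <= eps / (3 * K).
  by near: n; apply: e0; rewrite divr_gt0// mulr_gt0.
have h3 : K * e n <= eps / 3.
  move: h2; rewrite sub0r normrN => /(le_trans (ler_norm _)) h.
  rewrite (_ : eps / 3 = K * (eps / (3 * K))) ?ler_pM2l//.
  by field; rewrite gt_eqF.
have h4 : `|u n - normal_cdf v (t n)| <= normal_peak v * (3 * delta) + K * e n.
  by near: n; exact: H.
have h5 := normal_cdf_lipschitz t0 (t n) v0.
have h6 : normal_peak v * `|t0 - t n| <= eps / 3.
  rewrite (_ : eps / 3 = normal_peak v * (eps / (3 * normal_peak v))) ?ler_pM2l//.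
  by field; rewrite gt_eqF.
rewrite dE in h4; move: h4 (le_trans h5 h6); rewrite !ler_norml.
by move=> /andP[? ?] /andP[? ?]; apply/andP; split; lra.
Unshelve. all: end_near. Qed.

(** Slutsky's theorem for a product with a factor V that tends to 1 in probability.
    The factor is only asserted to exist off an event of vanishing
    probability. *)
Lemma slutsky_quotient v x (W Z : nat -> T -> R) : 0 < v ->
  (forall n y, measurable [set z | W n z <= y]) ->
  (forall n y, measurable [set z | Z n z <= y]) ->
  (forall y, prob [set z | W n z <= y] @[n --> \oo] --> normal_cdf v y) ->
  (forall eta, 0 < eta -> eta < 1 -> exists2 B : nat -> set T,
    (forall n, measurable (B n)) /\ prob (B n) @[n --> \oo] --> 0 &
    \forall n \near \oo, forall z, ~ B n z ->
      exists2 V, `|V - 1| <= eta & Z n z = V * W n z) ->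
  prob [set z | Z n z <= x] @[n --> \oo] --> normal_cdf v x.
Proof.
move=> v0 mW mZ cW H; have p0 : 0 < normal_peak v by rewrite normal_peak_gt0 ?gt_eqF.
apply/cvgrPdist_le => eps eps0.
pose eta := Num.min (2^-1) (eps / (3 * (normal_peak v * (2 * (`|x| + 1))))).
have x1 : 0 < `|x| + 1 by rewrite ltr_wpDl.
have eta0 : 0 < eta by rewrite lt_min invr_gt0 ltr0n /= divr_gt0// !mulr_gt0.
have eta2 : eta <= 2^-1 by rewrite ge_min lexx.
have etae : normal_peak v * (2 * (`|x| + 1) * eta) <= eps / 3.
  have : eta <= eps / (3 * (normal_peak v * (2 * (`|x| + 1)))) by rewrite ge_min lexx orbT.
  have q0 : 0 < normal_peak v * (2 * (`|x| + 1)) by rewrite !mulr_gt0.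
  rewrite ler_pdivlMr ?mulr_gt0//; lra.
have [B [mB B0] HB] := H eta eta0 ltac:(lra).
pose y1 := Num.min (x / (1 - eta)) (x / (1 + eta)).
pose y2 := Num.max (x / (1 - eta)) (x / (1 + eta)).
have e1 : 0 < 1 - eta by lra.
have e2 : 0 < 1 + eta by lra.
have xe : 0 <= (`|x| + 1) * eta by rewrite mulr_ge0// ltW.
have e3 : 0 <= 1 - 2 * eta by lra.
have := mulr_ge0 xe e3; have := mulr_ge0 xe (ltW eta0) => xe1 xe2.
have d1 : `|x - x / (1 - eta)| <= 2 * (`|x| + 1) * eta.
  rewrite (_ : x - _ = - (x * eta / (1 - eta))); last by field; rewrite gt_eqF.
  rewrite normrN !normrM normfV (gtr0_norm eta0) (gtr0_norm e1) ler_pdivrMr//.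
  by lra.
have d2 : `|x - x / (1 + eta)| <= 2 * (`|x| + 1) * eta.
  rewrite (_ : x - _ = x * eta / (1 + eta)); last by field; rewrite gt_eqF.
  rewrite !normrM normfV (gtr0_norm eta0) (gtr0_norm e2) ler_pdivrMr//.
  by lra.
have f y : `|x - y| <= 2 * (`|x| + 1) * eta ->
    `|normal_cdf v x - normal_cdf v y| <= eps / 3.
  move=> h; apply: le_trans (normal_cdf_lipschitz _ _ v0) _.
  by apply: le_trans etae; rewrite ler_pM2l.
have f1 : `|normal_cdf v x - normal_cdf v y1| <= eps / 3.
  by apply: f; rewrite /y1 minEle; case: ifP.
have f2 : `|normal_cdf v x - normal_cdf v y2| <= eps / 3.
  by apply: f; rewrite /y2 maxEle; case: ifP.
(* dividing the inequality V w <= x by V moves x by a factor between the two *)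
have bV V : `|V - 1| <= eta -> 0 < V /\ y1 <= x / V <= y2.
  rewrite ler_norml => /andP[V1 V2]; have V0 : 0 < V by lra.
  have i1 : (1 + eta)^-1 <= V^-1 by rewrite lef_pV2 ?posrE//; lra.
  have i2 : V^-1 <= (1 - eta)^-1 by rewrite lef_pV2 ?posrE//; lra.
  split=> //; have [x0|x0] := leP 0 x.
    rewrite /y1 /y2 ge_min le_max (ler_wpM2l x0 i1) (ler_wpM2l x0 i2).
    by rewrite orbT.
  rewrite /y1 /y2 ge_min le_max (ler_wnM2l (ltW x0) i1) (ler_wnM2l (ltW x0) i2).
  by rewrite orbT.
move/cvgrPdist_le : B0 => /(_ (eps / 3)) B0.
have c1 := cW y1; have c2 := cW y2.
move/cvgrPdist_le : c1 => /(_ (eps / 3)) c1.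
move/cvgrPdist_le : c2 => /(_ (eps / 3)) c2.
near=> n.
have HBn : forall z, ~ B n z -> exists2 V, `|V - 1| <= eta & Z n z = V * W n z.
  by near: n; exact: HB.
have g0 : `|0 - prob (B n)| <= eps / 3 by near: n; apply: B0; lra.
have g1 : `|normal_cdf v y1 - prob [set z | W n z <= y1]| <= eps / 3.
  by near: n; apply: c1; lra.
have g2 : `|normal_cdf v y2 - prob [set z | W n z <= y2]| <= eps / 3.
  by near: n; apply: c2; lra.
have k1 : prob [set z | W n z <= y1] <= prob (B n) + prob [set z | Z n z <= x].
  apply: prob_le_setU => // z /= Wz; have [|/HBn[V /bV[V0 /andP[V1 V2]] ->]] := pselect (B n z).
    by left.
  by right; rewrite mulrC -ler_pdivlMr// (le_trans Wz).
have k2 : prob [set z | Z n z <= x] <= prob (B n) + prob [set z | W n z <= y2].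
  apply: prob_le_setU => // z /= Zz; have [|/HBn[V /bV[V0 /andP[V1 V2]] E]] := pselect (B n z).
    by left.
  by right; rewrite (le_trans _ V2)// ler_pdivlMr// mulrC -E.
move: (f1) (f2) (g0) (g1) (g2); rewrite !ler_norml.
move=> /andP[? ?] /andP[? ?] /andP[? ?] /andP[? ?] /andP[? ?].
by apply/andP; split; lra.
Unshelve. all: end_near. Qed.

End ConvergenceOfLaws.

(** Here a and b stand for A/(n p) and B/(n p'), and r for p/p': the quotient of
    the counts is then a / b * r. *)
Lemma studentization_factor (R : realType) (D eta : R) : 0 < D -> 0 < eta ->
  exists2 eps, 0 < eps < 1 & forall a b r, `|a - 1| < eps -> `|b - 1| < eps ->
    `|r - (1 + D ^+ 2)| < eps ->
    1 < a / b * r /\ `|Num.sqrt a * (D / Num.sqrt (a / b * r - 1)) - 1| <= eta.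
Proof.
move=> D0 eta0; pose c : R * R * R := (1, 1, 1 + D ^+ 2).
have g : (p.1.1 / p.1.2 * p.2 - 1) @[p --> c] --> D ^+ 2.
  have -> : D ^+ 2 = 1 / 1 * (1 + D ^+ 2) - 1 by rewrite divr1 mul1r addrC addKr.
  apply: cvgB; last exact: cvg_cst.
  apply: cvgM; last exact: cvg_snd.
  apply: cvgM; first by apply: cvg_comp; [exact: cvg_fst|exact: cvg_fst].
  apply: cvgV; first by rewrite oner_eq0.
  by apply: cvg_comp; [exact: cvg_fst|exact: cvg_snd].
have f : (Num.sqrt p.1.1 * (D / Num.sqrt (p.1.1 / p.1.2 * p.2 - 1))) @[p --> c] -->
    Num.sqrt 1 * (D / Num.sqrt (D ^+ 2)).
  apply: cvgM.
    apply: (cvg_comp (fun p : R * R * R => p.1.1) Num.sqrt); last exact: sqrt_continuous.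
    by apply: cvg_comp; [exact: cvg_fst|exact: cvg_fst].
  apply: cvgMr; apply: cvgV; first by rewrite gt_eqF// sqrtr_gt0 exprn_gt0.
  by apply: (cvg_comp _ Num.sqrt g); exact: sqrt_continuous.
have D2 : 0 < D ^+ 2 by rewrite exprn_gt0.
have n1 : \forall p \near c, 0 < p.1.1 / p.1.2 * p.2 - 1 by exact: (cvgr_gt _ g).
rewrite sqrtr1 mul1r sqrtr_sqr gtr0_norm// divff ?gt_eqF// in f.
move/cvgrPdist_le : f => /(_ _ eta0) n2.
have n3 : nbhs c [set p | 0 < p.1.1 / p.1.2 * p.2 - 1 /\
    `|1 - Num.sqrt p.1.1 * (D / Num.sqrt (p.1.1 / p.1.2 * p.2 - 1))| <= eta].
  exact: filterI n1 n2.
have [e /= e0 He] := (nbhs_ballP c _).1 n3.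
exists (Num.min e 2^-1); first by rewrite lt_min e0 invr_gt0 ltr0n/= gt_min; apply/orP; right; lra.
move=> a b r; rewrite !lt_min => /andP[a1 _] /andP[b1 _] /andP[r1 _].
have cb : ball c e (a, b, r).
  by split => /=; [split => /=|]; rewrite /ball /= distrC.
have [h1 h2] := He _ cb; split; last by rewrite distrC.
by rewrite -subr_gt0.
Qed.

(** * Asymptotics of the tail index estimator *)

Section RealLemmas.
Context {R : realType}.
Implicit Types a b p y z : R.

(** This linearizes the event that the estimation error is small. *)
Lemma log_ratio_leE a b p (p' : R) y : 0 < a -> 0 < b -> 0 < p -> 0 < p' ->
  (ln a - ln b - (ln p - ln p') <= y) = (p' / p * expR (- y) * a - b <= 0).
Proof.
move=> a0 b0 p0 p'0.
have -> : (ln a - ln b - (ln p - ln p') <= y) = (ln (a / b / (p / p')) <= y).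
  by rewrite !ln_div ?posrE ?divr_gt0.
rewrite -[in LHS](@expRK _ y) ler_ln ?posrE ?expR_gt0 ?divr_gt0// expRN subr_le0.
have e0 := expR_gt0 y.
have k0 : 0 < p' / p / expR y by rewrite !divr_gt0.
rewrite ler_pdivrMr ?divr_gt0// ler_pdivrMr//.
have -> : expR y * (p / p') = (p' / p / expR y)^-1 by rewrite !invf_div mulrC.
by rewrite ler_pdivlMl.
Qed.

(** Squeezed by y / (1 + y) <= 1 - e^(-y) <= y. *)
Lemma scaled_expRN_cvg z (N : nat -> R) : N n @[n --> \oo] --> +oo ->
  N n * (1 - expR (- (z / N n))) @[n --> \oo] --> z.
Proof.
move=> Noo.
have N0 : \forall n \near \oo, 0 < N n by move/cvgryPgt : Noo => /(_ 0).
have iN : (N n)^-1 @[n --> \oo] --> 0 by apply/gtr0_cvgV0.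
have y0 : z / N n @[n --> \oo] --> 0.
  by rewrite -[X in _ --> X](mulr0 z); exact: cvgMr.
have l : z / (1 + z / N n) @[n --> \oo] --> z.
  rewrite -[X in _ --> X]divr1; apply: cvgMr.
  apply: cvgV; first exact: oner_neq0.
  by rewrite -[X in _ --> X]addr0; apply: cvgD; [exact: cvg_cst|exact: y0].
apply: (squeeze_cvgr _ l (cvg_cst z)).
have y1 : \forall n \near \oo, -1 < z / N n by apply: (cvgr_gt _ y0); lra.
near=> n.
have n0 : 0 < N n by near: n.
have y2 : 0 < 1 + z / N n by rewrite -ltrBlDl sub0r; near: n.
have zE : z = N n * (z / N n) by rewrite mulrCA divff ?mulr1// gt_eqF.
set y := z / N n in y2 zE *; rewrite zE -mulrA !ler_pM2l//.
have e0 := expR_gt0 (- y); have h := expR_ge1Dx y.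
have ee : expR (- y) * expR y = 1 by rewrite -expRD addNr expR0.
apply/andP; split; last by have := expR_ge1Dx (- y); lra.
rewrite ler_pdivrMr//.
have : expR (- y) * (1 + y) <= 1 by rewrite -[leRHS]ee ler_pM2l.
lra.
Unshelve. all: end_near. Qed.

End RealLemmas.

Section TailEstimation.
Context d0 (T0 : measurableType d0) (R : realType) (P0 : probability T0 R).
Context d (T : measurableType d) (P : probability T R).
Variables (S : {RV P0 >-> R}) (X : nat -> {RV P >-> R}).
Hypothesis iidX : iid_copies S X.
Local Notation prob := (prob P).

Lemma tail_copies l i : P [set z | expR l < X i z] = (tail S l)%:E.
Proof.
have [_ /(_ i _ (measurable_itv `]expR l, +oo[))] := iidX.
rewrite /tail /ccdf fineK ?fin_num_measure// => <-.
by congr (P _); apply/seteqP; split=> z; rewrite /= in_itv /= andbT.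
Qed.

Lemma empirical_tailE n l z :
  empirical_tail X n l z = n%:R^-1 * exceedances X (expR l) n z.
Proof.
congr (_ * _); apply: eq_bigr => i _; rewrite indicE.
by have [h|h] := boolP (expR l < X i z); [rewrite mem_set|rewrite memNset//=; apply/negP].
Qed.

Lemma exceedances_ge0 u n z : 0 <= exceedances X u n z.
Proof. exact: sumr_ge0. Qed.

Lemma exceedances_le u u' n z : u <= u' -> exceedances X u' n z <= exceedances X u n z.
Proof.
move=> uu'; apply: ler_sum => i _; rewrite ler_nat.
by have [/(le_lt_trans uu') ->|//] := boolP (u' < X i z).
Qed.

Lemma measurable_exceedances u n : measurable_fun setT (exceedances X u n).
Proof.
apply: measurable_sum => i.
rewrite (_ : (fun z => _) = \1_[set z | u < X i z]).
  apply: measurable_indic; rewrite -[X in measurable X]setTI.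
  by rewrite (_ : [set z | _] = X i @^-1` `]u, +oo[);
    [exact: measurable_funP|apply/seteqP; split=> z; rewrite /= in_itv /= andbT].
apply/funext => z; rewrite indicE.
by have [h|h] := boolP (u < X i z); [rewrite mem_set|rewrite memNset//=; apply/negP].
Qed.

Lemma measurable_empirical_tail n l : measurable_fun setT (empirical_tail X n l).
Proof.
rewrite (_ : empirical_tail X n l = fun z => n%:R^-1 * exceedances X (expR l) n z).
  by apply: measurable_funM => //; exact: measurable_exceedances.
by apply/funext => z; rewrite empirical_tailE.
Qed.

Lemma measurable_tail_index_estimator n l :
  measurable_fun setT (tail_index_estimator X n l).
Proof.
apply: measurable_fun_ifT => //.
  by apply: measurable_fun_ltr => //; exact: measurable_empirical_tail.
by apply: measurable_funB; apply: measurableT_comp => //;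
  exact: measurable_empirical_tail.
Qed.

Definition far_exceedances eps n l : set T :=
  [set z | eps <= `|exceedances X (expR l) n z / (n%:R * tail S l) - 1|].

Lemma measurable_far_exceedances eps n l : measurable (far_exceedances eps n l).
Proof.
rewrite -[X in measurable X]setTI; apply: measurable_fun_le => //.
apply: measurableT_comp => //; apply: measurable_funB => //.
by apply: measurable_funM => //; exact: measurable_exceedances.
Qed.

(** The variance of the count is at most its mean. *)
Lemma exceedances_concentration eps (l : nat -> R) : 0 < eps ->
  n%:R * tail S (l n) @[n --> \oo] --> +oo ->
  prob (far_exceedances eps n (l n)) @[n --> \oo] --> 0.
Proof.
move=> eps0 Noo; set N := fun n => n%:R * tail S (l n).
have N0 : \forall n \near \oo, 0 < N n by move/cvgryPgt : Noo => /(_ 0).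
have iN : (N n)^-1 @[n --> \oo] --> 0 by apply/gtr0_cvgV0.
have u0 : (eps ^+ 2)^-1 * (N n)^-1 @[n --> \oo] --> 0.
  by rewrite -[X in _ --> X](mulr0 (eps ^+ 2)^-1); exact: cvgMr.
apply: (squeeze_cvgr _ (cvg_cst 0) u0); near=> n.
have Nn : 0 < N n by near: n.
rewrite prob_ge0 /=.
have := @exceedances_chebyshev _ _ _ _ X (expR (l n)) (expR (l n)) _ _
  iidX.1 (lexx _) (tail_copies (l n)) (tail_copies (l n)) n _ (mulr_gt0 eps0 Nn).
rewrite -/(N n) (_ : N n / _ = (eps ^+ 2)^-1 * (N n)^-1); last first.
  by field; rewrite !gt_eqF.
apply: le_trans; rewrite le_eqVlt; apply/orP; left; apply/eqP; congr prob.
have E z : exceedances X (expR (l n)) n z - N n =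
    (exceedances X (expR (l n)) n z / N n - 1) * N n.
  by rewrite mulrBl divfK ?gt_eqF// mul1r.
by apply/seteqP; split=> z; rewrite /far_exceedances /= -/(N n) E normrM
  (gtr0_norm Nn) ler_pM2r.
Unshelve. all: end_near. Qed.

End TailEstimation.

Section TailIndexEstimator.
Context d0 (T0 : measurableType d0) (R : realType) (P0 : probability T0 R).
Context d (T : measurableType d) (P : probability T R).
Variables (S : {RV P0 >-> R}) (beta : R) (L : R -> R).
Variables (X : nat -> {RV P >-> R}) (k : nat -> R).
Hypothesis paretoS : discrete_generalized_pareto S beta L.
Hypothesis iidX : iid_copies S X.
Hypothesis k_cvg : k n @[n --> \oo] --> +oo.
Hypothesis size_k : (fun n => ln (n%:R : R) * expR (k n * beta) / n%:R) =o_\oo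
    (fun n => L (expR (k n))).

Local Notation prob := (prob P).
Local Notation D := (Num.sqrt (expR beta - 1)).
Local Notation p n := (tail S (k n)).
Local Notation p' n := (tail S (k n + 1)).
Local Notation far := (far_exceedances S X).

Definition estimation_error n z : R := Num.sqrt (n%:R * p n) *
  (tail_index_estimator X n (k n) z - log_tail_ratio S (k n)).

Lemma beta_gt0 : 0 < beta. Proof. by case: paretoS. Qed.

Lemma expR_beta_gt1 : 1 < expR beta.
Proof. by rewrite -expR0 ltr_expR beta_gt0. Qed.

Lemma asymptotic_std_gt0 : 0 < D.
Proof. by rewrite sqrtr_gt0 subr_gt0 expR_beta_gt1. Qed.

Lemma asymptotic_varE : D ^+ 2 = expR beta - 1.
Proof. by rewrite sqr_sqrtr// subr_ge0 ltW// expR_beta_gt1. Qed.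

Lemma size_gt0 : \forall n \near \oo, (0 < n)%N.
Proof. exact: nbhs_infty_gt. Qed.

Lemma near_tail1_gt0 : \forall n \near \oo, 0 < p' n.
Proof.
apply: near_tail_gt0 paretoS _; apply/cvgryPge => A; near=> n.
have : A <= k n by near: n; move/cvgryPge : k_cvg => /(_ A).
lra.
Unshelve. all: end_near. Qed.

Lemma size_tail1_cvgy : n%:R * p' n @[n --> \oo] --> +oo.
Proof.
have h := size_tail_cvgy paretoS k_cvg size_k.
have q := tail_ratio_cvg paretoS k_cvg.
have e0 := expR_gt0 (- beta).
have q1 : \forall n \near \oo, expR (- beta) / 2 < p' n / p n.
  by apply: (cvgr_gt _ q); lra.
apply/cvgryPge => A; near=> n.
have h1 : 2 / expR (- beta) * `|A| <= n%:R * p n.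
  by near: n; move/cvgryPge : h => /(_ (2 / expR (- beta) * `|A|)).
have h2 : expR (- beta) / 2 < p' n / p n by near: n.
have p0 : 0 < p n by near: n; exact: near_tail_gt0 paretoS k_cvg.
have -> : n%:R * p' n = (n%:R * p n) * (p' n / p n) by field; rewrite gt_eqF.
apply: le_trans (ler_norm A) _.
have -> : `|A| = (2 / expR (- beta) * `|A|) * (expR (- beta) / 2).
  by field; rewrite gt_eqF.
apply: ler_pM h1 (ltW h2); last by rewrite divr_ge0// ltW.
by rewrite mulr_ge0// divr_ge0// ltW.
Unshelve. all: end_near. Qed.

Lemma tail_cvg0 : p n @[n --> \oo] --> 0.
Proof.
have kk : expR (k n) @[n --> \oo] --> +oo.
  apply/cvgryPge => A; near=> n.
  have kA : A <= k n by near: n; move/cvgryPge : k_cvg => /(_ A).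
  by have := expR_ge1Dx (k n); lra.
apply: (@fine_cvg _ _ _ _ (fun n => ccdf S (expR (k n)))).
exact: (cvg_comp (fun n => expR (k n)) (ccdf S) kk (@cvg_ccdfy0 _ _ _ _ S)).
Unshelve. all: end_near. Qed.

Lemma exceedances_gt0 n l z : 0 < n%:R * tail S l -> ~ far 2^-1 n l z ->
  0 < exceedances X (expR l) n z.
Proof.
move=> N0 /negP; rewrite -ltNge => h.
rewrite lt_neqAle exceedances_ge0 andbT eq_sym; apply/eqP => e0.
by move: h; rewrite e0 mul0r sub0r normrN normr1; lra.
Qed.

Lemma log_exceedances_gt0 n z : 0 < exceedances X (expR (k n + 1)) n z -> (0 < n)%N ->
  tail_index_estimator X n (k n) z =
  ln (n%:R^-1 * exceedances X (expR (k n)) n z) -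
  ln (n%:R^-1 * exceedances X (expR (k n + 1)) n z).
Proof.
move=> B0 n0; rewrite /tail_index_estimator !empirical_tailE.
by rewrite mulr_gt0 ?invr_gt0 ?ltr0n.
Qed.

Lemma exceedances_k_le n z :
  exceedances X (expR (k n + 1)) n z <= exceedances X (expR (k n)) n z.
Proof. by apply: exceedances_le; rewrite ler_expR lerDl. Qed.

Lemma measurable_estimation_error n : measurable_fun setT (estimation_error n).
Proof.
apply: measurable_funM => //; apply: measurable_funB => //.
exact: measurable_tail_index_estimator.
Qed.

Lemma measurable_le (f : T -> R) y : measurable_fun setT f ->
  measurable [set z | f z <= y].
Proof.
by move=> mf; rewrite -[X in measurable X]setTI; exact: measurable_fun_le.
Qed.

(** The normal law has an arbitrary standard deviation v, so that the result serves
    both for both convergences. *)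
Section CentralLimit.
Variables (v x : R).
Hypothesis v0 : 0 < v.
(* the threshold of the event in terms of the error itself, not of its rescaling *)
Let z0 := x * D / v.
Let N n := Num.sqrt (n%:R * p n).
Let c n := p' n / p n * expR (- (z0 / N n)).

Let N_cvg : N n @[n --> \oo] --> +oo.
Proof.
apply/cvgryPge => A; near=> n.
have : A ^+ 2 <= n%:R * p n.
  by near: n; have /cvgryPge/(_ (A ^+ 2)) := size_tail_cvgy paretoS k_cvg size_k.
move/ler_wsqrtr; rewrite sqrtr_sqr; apply: le_trans; exact: ler_norm.
Unshelve. all: end_near. Qed.

Let N_gt0 : \forall n \near \oo, 0 < N n.
Proof. by move/cvgryPgt : N_cvg => /(_ 0). Qed.

Let iN_cvg : (N n)^-1 @[n --> \oo] --> 0.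
Proof. by apply/gtr0_cvgV0. Qed.

Lemma threshold_cvg : c n @[n --> \oo] --> expR (- beta).
Proof.
have y0 : z0 / N n @[n --> \oo] --> 0.
  by rewrite -[X in _ --> X](mulr0 z0); apply: cvgMr.
have y1 : - (z0 / N n) @[n --> \oo] --> 0.
  by rewrite -[X in _ --> X]oppr0; apply: cvgN.
have e1 : expR (- (z0 / N n)) @[n --> \oo] --> expR 0.
  by apply: (cvg_comp _ (@expR R) y1); exact: continuous_expR.
rewrite expR0 in e1; rewrite -[X in _ --> X]mulr1.
by apply: cvgM => //; exact: tail_ratio_cvg paretoS k_cvg.
Qed.

Let q := expR (- beta).
(* the variance of a step of c A - B, divided by p *)
Let relvar n := c n ^+ 2 - 2 * c n * (p' n / p n) + p' n / p n -
  p n * (c n - p' n / p n) ^+ 2.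

Let relvar_cvg : relvar n @[n --> \oo] --> q * (1 - q).
Proof.
have cq := threshold_cvg; have qq := tail_ratio_cvg paretoS k_cvg.
have sqr (f : nat -> R) (l : R) : f n @[n --> \oo] --> l -> f n ^+ 2 @[n --> \oo] --> l ^+ 2.
  by move=> fl; apply: (cvg_comp _ (fun y => y ^+ 2) fl); exact: exprn_continuous.
have -> : q * (1 - q) = q ^+ 2 - 2 * q * q + q - 0 * (q - q) ^+ 2 by ring.
apply: cvgB.
  apply: cvgD => //; apply: cvgB; first exact: sqr.
  by apply: cvgM => //; apply: cvgMr.
apply: cvgM; first exact: tail_cvg0.
by apply: sqr; apply: cvgB.
Qed.

Let q01 : 0 < q < 1.
Proof. by rewrite expR_gt0 /= -[ltRHS]expR0 ltr_expR oppr_lt0 beta_gt0. Qed.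

Let relvar_lim_gt0 : 0 < q * (1 - q).
Proof. by case/andP: q01 => a b; rewrite mulr_gt0// subr_gt0. Qed.

Let r n := v / Num.sqrt (relvar n) * (N n)^-1.

Let sd_cvg : v / Num.sqrt (relvar n) @[n --> \oo] --> v / Num.sqrt (q * (1 - q)).
Proof.
apply: cvgMr; apply: cvgV; first by rewrite gt_eqF// sqrtr_gt0.
by apply: (cvg_comp _ Num.sqrt relvar_cvg); exact: sqrt_continuous.
Qed.

Let r_cvg : r n @[n --> \oo] --> 0.
Proof.
rewrite -[X in _ --> X](mulr0 (v / Num.sqrt (q * (1 - q)))).
by apply: cvgM => //; exact: sd_cvg.
Qed.

Let t n := - (r n * (n%:R * (c n * p n + -1 * p' n))).

Let t_cvg : t n @[n --> \oo] --> x.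
Proof.
have /andP[q0 q1] := q01.
have D0 := asymptotic_std_gt0.
have h := @scaled_expRN_cvg _ z0 N N_cvg.
have -> : x = v / Num.sqrt (q * (1 - q)) * (q * z0).
  have -> : Num.sqrt (q * (1 - q)) = q * D.
    rewrite -[RHS]gtr0_norm ?mulr_gt0// -sqrtr_sqr; congr Num.sqrt.
    by rewrite exprMn asymptotic_varE /q expRN; field; rewrite gt_eqF// expR_gt0.
  by rewrite /z0; field; rewrite !gt_eqF.
have H : v / Num.sqrt (relvar n) * (p' n / p n * (N n * (1 - expR (- (z0 / N n)))))
    @[n --> \oo] --> v / Num.sqrt (q * (1 - q)) * (q * z0).
  apply: cvgM; first exact: sd_cvg.
  by apply: cvgM => //; exact: tail_ratio_cvg paretoS k_cvg.
apply: cvg_trans H; apply: near_eq_cvg; near=> n.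
have p0 : 0 < p n by near: n; exact: near_tail_gt0 paretoS k_cvg.
have N0 : 0 < N n by near: n; exact: N_gt0.
have NE : n%:R = N n ^+ 2 / p n.
  by rewrite /N sqr_sqrtr ?mulr_ge0// ?(ltW p0)// mulfK// gt_eqF.
rewrite /t /r {1}NE /c.
move: (Num.sqrt (relvar n))^-1 (expR _) => y e.
by field; rewrite !gt_eqF.
Unshelve. all: end_near. Qed.

(** The scale r n is of order (n p)^(-1/2), which makes the steps small, and the
    scaled mean converges to - x by the choice of c. *)
Lemma exceedances_clt : prob [set z | c n * exceedances X (expR (k n)) n z +
    -1 * exceedances X (expR (k n + 1)) n z <= 0] @[n --> \oo] --> normal_cdf v x.
Proof.
have e_cvg : 2 * r n * (`|c n| + `|-1|) @[n --> \oo] --> 0.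
  rewrite -[X in _ --> X](mul0r (`|q| + `|-1|)) -(mulr0 2).
  apply: cvgM; first by apply: cvgMr.
  by apply: cvgD; [apply: cvg_norm; exact: threshold_cvg|exact: cvg_cst].
apply: (cvg_normal_cdf_of_bound v0 t_cvg e_cvg) => delta delta0.
have V0near : \forall n \near \oo, 0 < relvar n by exact: (cvgr_gt _ relvar_cvg).
near=> n.
have n0 : (0 < n)%N by near: n; exact: size_gt0.
have p0 : 0 < p n by near: n; exact: near_tail_gt0 paretoS k_cvg.
have V0 : 0 < relvar n by near: n; exact: V0near.
have VE : level_var (p n) (p' n) (c n) (-1) = p n * relvar n.
  by rewrite /level_var /relvar; field; rewrite gt_eqF.
have kk : expR (k n) <= expR (k n + 1) by rewrite ler_expR lerDl.
have rE : r n = v / (Num.sqrt (level_var (p n) (p' n) (c n) (-1)) * Num.sqrt n%:R).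
  rewrite VE /r /N !sqrtrM ?(ltW p0)// -mulrA -invfM; congr (_ / _); ring.
apply: (exceedances_cdf_normal iidX.1 kk (tail_copies iidX (k n))
  (tail_copies iidX (k n + 1)) n0 v0 delta0 _ rE).
by rewrite VE mulr_gt0.
Unshelve. all: end_near. Qed.

(** The two events differ only where B is far from its mean. *)
Lemma estimation_error_clt :
  prob [set z | estimation_error n z * (v / D) <= x] @[n --> \oo] --> normal_cdf v x.
Proof.
have h0 : (0 : R) < 2^-1 by rewrite invr_gt0.
have bad0 := exceedances_concentration iidX h0 size_tail1_cvgy.
pose E2 n := [set z | c n * exceedances X (expR (k n)) n z +
    -1 * exceedances X (expR (k n + 1)) n z <= 0].
pose bad n := prob (far 2^-1 n (k n + 1)).
have E2c := exceedances_clt.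
have lo : prob (E2 n) - bad n @[n --> \oo] --> normal_cdf v x.
  by rewrite -[X in _ --> X]subr0; apply: cvgB.
have hi : bad n + prob (E2 n) @[n --> \oo] --> normal_cdf v x.
  by rewrite -[X in _ --> X]add0r; apply: cvgD.
apply: (squeeze_cvgr _ lo hi); near=> n.
have n0 : (0 < n)%N by near: n; exact: size_gt0.
have p0 : 0 < p n by near: n; exact: near_tail_gt0 paretoS k_cvg.
have p'0 : 0 < p' n by near: n; exact: near_tail1_gt0.
have N0 : 0 < N n by near: n; exact: N_gt0.
have D0 := asymptotic_std_gt0.
have nR : 0 < n%:R^-1 :> R by rewrite invr_gt0 ltr0n.
have key z : ~ far 2^-1 n (k n + 1) z ->
    (estimation_error n z * (v / D) <= x) =
    (c n * exceedances X (expR (k n)) n z +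
      -1 * exceedances X (expR (k n + 1)) n z <= 0).
  move=> nf; have B0 : 0 < exceedances X (expR (k n + 1)) n z.
    by apply: exceedances_gt0 nf; rewrite mulr_gt0 ?ltr0n.
  have A0 := lt_le_trans B0 (exceedances_k_le n z).
  rewrite /estimation_error log_exceedances_gt0// -/(N n) mulrC -ler_pdivlMl ?divr_gt0//.
  rewrite invf_div -ler_pdivlMl// (_ : _ * (_ * x) = z0 / N n); last first.
    by rewrite /z0; field; rewrite !gt_eqF.
  rewrite /log_tail_ratio log_ratio_leE ?mulr_gt0// -/(c n).
  by rewrite mulrCA -mulrBr pmulr_rle0// mulN1r.
have mE1 : measurable [set z | estimation_error n z * (v / D) <= x].
  apply: measurable_le; apply: measurable_funM => //.
  exact: measurable_estimation_error.
have mE2 : measurable (E2 n).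
  by apply: measurable_le; apply: measurable_funD; apply: measurable_funM => //;
    exact: measurable_exceedances.
have mb := measurable_far_exceedances S X 2^-1 n (k n + 1).
rewrite lerBlDl; apply/andP; split; apply: prob_le_setU => // z Hz;
  have [|nf] := pselect (far 2^-1 n (k n + 1) z); try by left.
- by right; rewrite /= key.
- by right; move: Hz; rewrite /= key.
Unshelve. all: end_near. Qed.

End CentralLimit.

End TailIndexEstimator.

Lemma cvg_in_distribution_normal d (T : measurableType d) (R : realType)
    (P : probability T R) (Y : nat -> T -> R) (v : R) :
  (forall n, measurable_fun setT (Y n)) ->
  (forall x, prob P [set z | Y n z <= x] @[n --> \oo] --> normal_cdf v x) ->
  cvg_in_distribution P Y (normal_prob 0 v).
Proof.
move=> mY H; split=> // x _.
rewrite -[X in _ --> X]fineK; last by rewrite fin_num_measure.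
apply: cvg_EFin; last exact: H.
by apply: nearW => n; rewrite fin_num_measure//; exact: measurable_le.
Qed.

Theorem theorem2p2 (R : realType)
  (d0 : measure_display) (T0 : measurableType d0) (P0 : probability T0 R)
  (S : {RV P0 >-> R}) (beta : R) (L : R -> R)
  (d : measure_display) (T : measurableType d) (P : probability T R)
  (X : nat -> {RV P >-> R}) (k : nat -> R) (c : R) :
  discrete_generalized_pareto S beta L ->
  iid_copies S X ->
  k n @[n --> \oo] --> +oo ->
  (fun n => ln (n%:R : R) * expR (k n * beta) / n%:R) =o_\oo
    (fun n => L (expR (k n))) ->
  cvg_in_distribution P
    (fun n w => Num.sqrt (n%:R * tail S (k n)) *
      (tail_index_estimator X n (k n) w - log_tail_ratio S (k n)))
    (centered_normal (expR beta - 1))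
  /\
  (* [c] is the arbitrary value of the ratio where its denominator vanishes *)
  cvg_in_distribution P
    (fun n w =>
      let den := Num.sqrt (expR (tail_index_estimator X n (k n) w) - 1) in
      if den == 0 then c
      else Num.sqrt (n%:R * empirical_tail X n (k n) w) *
        (tail_index_estimator X n (k n) w - log_tail_ratio S (k n)) / den)
    (centered_normal 1).
Proof.
move=> paretoS iidX k_cvg size_k.
have D0 := asymptotic_std_gt0 paretoS.
have mest n := measurable_tail_index_estimator X n (k n).
have memp n := measurable_empirical_tail X n (k n).
have clt v x v0 := @estimation_error_clt _ _ _ _ _ _ _ S beta L X k paretoS iidX
  k_cvg size_k v x v0.
have msqrt : measurable_fun setT (@Num.sqrt R).
  by apply: continuous_measurable_fun; exact: sqrt_continuous.
split.
  apply: cvg_in_distribution_normal => [n|x]; first exact: measurable_estimation_error.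
  have := clt _ x D0.
  by under eq_fun do (under eq_set do rewrite divff ?gt_eqF// mulr1).
rewrite /centered_normal sqrtr1.
set Z := fun (n : nat) (w : T) => _.
have mZ n : measurable_fun setT (Z n).
  pose den w := Num.sqrt (expR (tail_index_estimator X n (k n) w) - 1).
  have mden : measurable_fun setT den.
    apply: (measurableT_comp msqrt); apply: measurable_funB => //.
    by apply: measurableT_comp => //; exact: mest.
  (* the exponential of [- ln] is the inverse on the positive denominators *)
  have -> : Z n = fun w => if den w == 0 then c else
      Num.sqrt (n%:R * empirical_tail X n (k n) w) *
      (tail_index_estimator X n (k n) w - log_tail_ratio S (k n)) *
      expR (- ln (den w)).
    apply/funext => w; rewrite /Z /= -/(den w); case: ifPn => // den0.
    by rewrite expRN lnK// posrE lt_neqAle eq_sym den0 sqrtr_ge0.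
  apply: measurable_fun_ifT => //; first exact: measurable_fun_eqr.
  apply: measurable_funM.
    apply: measurable_funM; last exact: measurable_funB.
    by apply: (measurableT_comp msqrt); exact: measurable_funM.
  apply: measurableT_comp => //; apply: measurableT_comp => //.
  exact: measurableT_comp.
apply: cvg_in_distribution_normal => // x.
pose W n z := estimation_error S X k n z * (1 / Num.sqrt (expR beta - 1)).
have mW n : measurable_fun setT (W n).
  by apply: measurable_funM => //; exact: measurable_estimation_error.
apply: (@slutsky_quotient _ _ _ P 1 x W Z) => //.
- by move=> n y; exact: measurable_le.
- by move=> n y; exact: measurable_le.
- by move=> y; exact: clt.
move=> eta eta0 _.
have [eps /andP[eps0 eps1] Heps] := studentization_factor D0 eta0.
exists (fun n => far_exceedances S X eps n (k n) `|` far_exceedances S X eps n (k n + 1)).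
  split=> [n|]; first by apply: measurableU; exact: measurable_far_exceedances.
  have c1 := exceedances_concentration iidX eps0 (size_tail_cvgy paretoS k_cvg size_k).
  have c2 := exceedances_concentration iidX eps0 (size_tail1_cvgy paretoS k_cvg size_k).
  have c12 : prob P (far_exceedances S X eps n (k n)) +
      prob P (far_exceedances S X eps n (k n + 1)) @[n --> \oo] --> 0.
    by rewrite -[X in _ --> X]addr0; apply: cvgD.
  apply: (squeeze_cvgr _ (cvg_cst 0) c12); near=> n.
  rewrite prob_ge0 /=; apply: prob_le_setU => //;
    try apply: measurableU; exact: measurable_far_exceedances.
have ratio : tail S (k n) / tail S (k n + 1) @[n --> \oo] -->
    1 + Num.sqrt (expR beta - 1) ^+ 2.
  rewrite (asymptotic_varE paretoS) addrC subrK -[beta]opprK expRN.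
  have h : (tail S (k n + 1) / tail S (k n))^-1 @[n --> \oo] --> (expR (- beta))^-1.
    apply: cvgV; first by rewrite gt_eqF// expR_gt0.
    exact: tail_ratio_cvg paretoS k_cvg.
  by under eq_fun do rewrite -invf_div.
near=> n => z /not_orP[/negP nA /negP nB].
rewrite -!ltNge in nA nB.
have n0 : (0 < n)%N by near: n; exact: nbhs_infty_gt.
have nR : (0 : R) < n%:R by rewrite ltr0n.
have p0 : 0 < tail S (k n) by near: n; exact: near_tail_gt0 paretoS k_cvg.
have p'0 : 0 < tail S (k n + 1) by near: n; exact: near_tail1_gt0 paretoS k_cvg.
have rn : `|tail S (k n) / tail S (k n + 1) - (1 + Num.sqrt (expR beta - 1) ^+ 2)| < eps.
  by rewrite distrC; near: n; move/cvgrPdist_lt : ratio => /(_ _ eps0).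
set A := exceedances X (expR (k n)) n z in nA.
set B := exceedances X (expR (k n + 1)) n z in nB.
have B0 : 0 < B.
  rewrite lt_neqAle exceedances_ge0 andbT eq_sym; apply/eqP => e0.
  by move: nB; rewrite e0 mul0r sub0r normrN normr1 ltNge (ltW eps1).
have A0 : 0 < A := lt_le_trans B0 (exceedances_k_le X k n z).
have [] := Heps _ _ _ nA nB rn.
have -> : A / (n%:R * tail S (k n)) / (B / (n%:R * tail S (k n + 1))) *
    (tail S (k n) / tail S (k n + 1)) = A / B.
  by field; rewrite !gt_eqF.
move=> AB HV; set a := A / (n%:R * tail S (k n)) in HV *.
exists (Num.sqrt a * (Num.sqrt (expR beta - 1) / Num.sqrt (A / B - 1))) => //.
have est : expR (tail_index_estimator X n (k n) z) = A / B.
  rewrite log_exceedances_gt0// -ln_div ?posrE ?mulr_gt0 ?invr_gt0//.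
  rewrite lnK ?posrE ?divr_gt0 ?mulr_gt0 ?invr_gt0// -/A -/B.
  by field; rewrite !gt_eqF.
have den0 : 0 < Num.sqrt (A / B - 1) by rewrite sqrtr_gt0 subr_gt0.
rewrite /Z /= est gt_eqF// /W /estimation_error empirical_tailE -/A mulVKf ?gt_eqF//.
have -> : Num.sqrt A = Num.sqrt a * Num.sqrt (n%:R * tail S (k n)).
  rewrite -sqrtrM; last by rewrite divr_ge0 ?mulr_ge0// ltW.
  by rewrite /a divfK// gt_eqF// mulr_gt0.
by field; rewrite !gt_eqF.
Unshelve. all: end_near. Qed.
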